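(* Let $b$ be a function with domain $\omega$ and $h\in\omega^\omega$ such that $1\leq^* h$, $b(i)\neq\emptyset$ for every $i<\omega$, and $h(i)<|b(i)|$ for all but finitely many $i<\omega$. \begin{enumerate}[(a)] \item If $b(i)$ is infinite for all but finitely many $i<\omega$ then \[\mathfrak{b}^{\mathrm{aLc}}_{b,h}=\max\{\mathrm{cof}([\kappa]^{\aleph_0}),\mathrm{non}(\mathcal{M})\}\text{ and }\mathfrak{d}^{\mathrm{aLc}}_{b,h}=\min\{\mathrm{add}([\kappa]^{\aleph_0}),\mathrm{cov}(\mathcal{M})\}\] where $\kappa=\liminf_{i<\omega}\{|b(i)|\}$. In particular, if $\kappa=\omega$ then $\mathfrak{b}^{\mathrm{aLc}}_{b,h}=\mathrm{non}(\mathcal{M})$ and $\mathfrak{d}^{\mathrm{aLc}}_{b,h}=\mathrm{cov}(\mathcal{M})$; otherwise, if $\kappa$ is uncountable then $\mathfrak{d}^{\mathrm{aLc}}_{b,h}=\aleph_1$. \item If $b(i)$ is infinite for infinitely many $i<\omega$ then \[\mathfrak{b}^{\mathrm{Lc}}_{b,h}=\min\{\mathrm{add}([\lambda]^{\aleph_0}),\mathfrak{b}^{\mathrm{Lc}}_{\omega,h}\}\text{ and }\mathfrak{d}^{\mathrm{Lc}}_{b,h}=\max\{\mathrm{cof}([\lambda]^{\aleph_0}),\mathfrak{d}^{\mathrm{Lc}}_{\omega,h}\}\] where $\lambda=\limsup_{i<\omega}\{|b(i)|\}$. In particular, if $\lambda=\omega$ then $\mathfrak{b}^{\mathrm{Lc}}_{b,h}=\mathfrak{b}^{\mathrm{Lc}}_{\omega,h}$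 and $\mathfrak{d}^{\mathrm{Lc}}_{b,h}=\mathfrak{d}^{\mathrm{Lc}}_{\omega,h}$; if $\lambda$ is uncountable and $h$ goes to infinity then $\mathfrak{b}^{\mathrm{Lc}}_{b,h}=\aleph_1$. \end{enumerate}
   Context: Notation: $\mathcal{S}(b,h)=\prod_{n<\omega}[b(n)]^{\leq h(n)}$ (slaloms), $\prod b=\prod_{i<\omega}b(i)$. For functions $x,\varphi$ with domain $\omega$: $x\in^*\varphi$ iff $x(n)\in\varphi(n)$ for all but finitely many $n$; $\varphi\not\ni^* x$ (''$\varphi$ anti-localizes $x$'') iff $x(n)\in\varphi(n)$ for only finitely many $n$. Localization cardinals: $\mathfrak{b}^{\mathrm{Lc}}_{b,h}$ is the least size of a family $F\subseteq\prod b$ such that no single $\varphi\in\mathcal{S}(b,h)$ satisfies $x\in^*\varphi$ for all $x\in F$; $\mathfrak{d}^{\mathrm{Lc}}_{b,h}$ is the least size of a family $\Phi\subseteq\mathcal{S}(b,h)$ such that every $x\in\prod b$ satisfies $x\in^*\varphi$ for some $\varphi\in\Phi$. Anti-localization cardinals: $\mathfrak{b}^{\mathrm{aLc}}_{b,h}$ is the least size of a family $\Phi\subseteq\mathcal{S}(b,h)$ such that no single $y\in\prod b$ is anti-localized by every $\varphi\in\Phi$; $\mathfrak{d}^{\mathrm{aLc}}_{b,h}$ is the least size of a family $D\subseteq\prod b$ such that for every $\varphi\in\mathcal{S}(b,h)$ there is $y\in D$ with $\varphi\not\ni^* y$. Here $\omega$ as the subscript $b$ denotes the constant function with value $\omega$.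 $\mathcal{M}$ is the meager ideal on the reals. Convention: $\mathrm{cof}([\omega]^{\aleph_0})=1$ and $\mathrm{add}([\omega]^{\aleph_0})$ is undefined, interpreted as something above all cardinals; $\mathrm{add}([\kappa]^{\aleph_0})=\aleph_1$ for uncountable $\kappa$. *)

(* Defs.v *)
From HB Require Import structures.
From mathcomp Require Import all_boot all_order all_algebra.
From mathcomp Require Import all_classical all_reals all_analysis.

Set Implicit Arguments.
Unset Strict Implicit.
Unset Printing Implicit Defensive.

Import numFieldNormedType.Exports.

Local Open Scope classical_set_scope.
Local Open Scope card_scope.

(* A cardinal is an equivalence class of types under equinumerosity. Classes of
   types are written [Type -> Prop] and not [set Type]: with the latter no set
   of sets could itself be given a cardinality, for universe reasons. *)
Record cardinal := Cardinal {
  cardinal_class : Type -> Prop ;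
  cardinal_classP :
    exists A : Type, cardinal_class = (fun B : Type => [set: A] #= [set: B]) }.

Definition cardof (A : Type) : cardinal := Cardinal (ex_intro _ A erefl).

Definition carrier (k : cardinal) : Type := sval (cid (cardinal_classP k)).

Definition cle (k l : cardinal) : Prop := [set: carrier k] #<= [set: carrier l].

Lemma eq_cardof (A B : Type) :
  cardof A = cardof B <-> [set: A] #= [set: B].
Proof.
split=> [[AB]|AB].
  by have := congr1 (fun C => C B) AB => /= ->; exact: card_eqxx.
suff: (fun C : Type => [set: A] #= [set: C]) =
      (fun C => [set: B] #= [set: C]) :> (Type -> Prop).
  move=> E; rewrite /cardof; move: (ex_intro _ A _) (ex_intro _ B _) => /=.
  by rewrite E => p q; congr Cardinal; exact: Prop_irrelevance.
by apply/funext => C; rewrite (card_eql AB).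
Qed.

Lemma carrierK k : cardof (carrier k) = k.
Proof.
rewrite /carrier; case: (cid _) => A /= kA.
case: k kA => C Cex /= kA; rewrite /cardof; move: (ex_intro _ A _) => /=.
by rewrite -kA => p; congr Cardinal; exact: Prop_irrelevance.
Qed.

Lemma carrier_cardof (A : Type) : [set: carrier (cardof A)] #= [set: A].
Proof. by apply/eq_cardof; rewrite carrierK. Qed.

Lemma cle_cardof (A B : Type) :
  cle (cardof A) (cardof B) <-> [set: A] #<= [set: B].
Proof.
rewrite /cle (card_le_eql (carrier_cardof A)).
by rewrite (card_le_eqr (carrier_cardof B)).
Qed.

Lemma cle_anti k l : cle k l -> cle l k -> k = l.
Proof.
move=> kl lk; rewrite -(carrierK k) -(carrierK l); apply/eq_cardof.
by rewrite card_eq_le; apply/andP.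
Qed.

Lemma inj_cle (A B : Type) (f : A -> B) : injective f -> [set: A] #<= [set: B].
Proof.
move=> f_inj; have [] : $|{injfun [set: A] >-> [set: B]}|.
  by apply/injfunPex; exists f => // x y _ _ /f_inj.
exact: inj_card_le.
Qed.

Lemma least_type (I : Type) (i0 : I) (A : I -> Type) :
  exists i, forall j, [set: A i] #<= [set: A j].
Proof.
pose P (S : set (forall i, A i)) :=
  forall i f g, S f -> S g -> f i = g i -> f = g.
have [|S [PS Smax]] := @Zorn_bigcup _ P.
  move=> F FP Ftot i f g [X FX Xf] [Y FY Yg].
  by have [XY|YX] := Ftot _ _ FX FY;
    [apply: FP FY i f g (XY _ Xf) Yg | apply: FP FX i f g Xf (YX _ Yg)].
have [i Si] : exists i, forall a : A i, exists f, S f /\ f i = a.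
  apply: contrapT => /forallNP noi.
  have notin i : {a : A i | forall f, S f -> f i <> a}.
    apply: cid; have /existsNP[a /forallNP na] := noi i.
    by exists a => f Sf fa; apply: (na f).
  pose g i := sval (notin i); have gS i := svalP (notin i).
  have gNS : ~ S g by move=> Sg; exact: gS i0 g Sg erefl.
  apply: (Smax (S `|` [set g])).
    by split=> [f|/(_ g (or_intror erefl))//]; left.
  move=> i f f' [Sf|->] [Sf'|->] // E; first exact: PS E.
    by case: (gS i f Sf).
  by case: (gS i f' Sf').
exists i => j; have [F FS] := choice Si.
apply: (@inj_cle _ _ (fun a => F a j)) => a a' /PS E.
by rewrite -(FS a).2 -(FS a').2 E //; [exact: (FS a).1|exact: (FS a').1].
Qed.

Lemma cle_total k l : cle k l \/ cle l k.
Proof.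
have [[] lei] := least_type true (fun c => if c then carrier k else carrier l).
  by left; exact: (lei false).
by right; exact: (lei true).
Qed.

Definition clt (k l : cardinal) : Prop := cle k l /\ k <> l.

(* The least cardinal satisfying P; junk value if no cardinal satisfies P. *)
Definition cmin (P : cardinal -> Prop) : cardinal :=
  if pselect (exists k, P k /\ forall l, P l -> cle k l) is left minP
  then sval (cid minP) else cardof void.

Lemma cminP (P : cardinal -> Prop) :
  (exists k, P k) -> P (cmin P) /\ forall l, P l -> cle (cmin P) l.
Proof.
move=> [k Pk]; rewrite /cmin; case: pselect => [e|[]]; first by case: cid.
pose J := {X : set (carrier k) | P (cardof X)}.
have sub l : P l -> cle l k -> exists X : J, cardof (sval X) = l.
  move=> Pl /card_leP[f].
  pose g x := val (f (SigSub (mem_set (I : [set: carrier l] x)))).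
  have g_inj : injective g.
    by move=> x y /val_inj/inj; rewrite !inE => /(_ I I) [].
  have E : cardof (range g) = l.
    rewrite -[RHS]carrierK; apply/eq_cardof.
    rewrite (card_eql (card_setT _)) (card_eql (inj_card_eq _)) ?card_eqxx//.
    by move=> x y _ _ /g_inj.
  have PX : P (cardof (range g)) by rewrite E.
  by exists (exist (fun X : set (carrier k) => P (cardof X)) _ PX).
have [X0 X0k] := sub k Pk (card_lexx _).
have [[X PX] Xmin] := least_type X0 (fun X : J => set_type (sval X)).
exists (cardof X); split=> // l Pl.
have Xle Y : cle (cardof X) (cardof (sval (Y : J))) by exact/cle_cardof/Xmin.
have [kl|/(sub l Pl)[Y <-]] := cle_total k l; last exact: Xle.
by have := Xle X0; rewrite X0k => /card_le_trans; apply.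
Qed.

Definition csup (P : cardinal -> Prop) : cardinal :=
  cmin (fun k => forall l, P l -> cle l k).

Definition climinf (s : nat -> cardinal) : cardinal :=
  csup (fun k => exists n, k = cmin (fun l => exists2 i, (n <= i)%N & l = s i)).

Definition climsup (s : nat -> cardinal) : cardinal :=
  cmin (fun k => exists n, k = csup (fun l => exists2 i, (n <= i)%N & l = s i)).

Definition aleph0 : cardinal := cardof nat.

Definition uncountable (k : cardinal) : Prop := ~ cle k aleph0.

Definition aleph1 : cardinal := cmin uncountable.

(* [None] is a value above all cardinals. *)
Definition ecardinal := option cardinal.

Definition ele (x y : ecardinal) : Prop :=
  match x, y with
  | _, None => True
  | None, Some _ => False
  | Some k, Some l => cle k l
  end.

Definition emin (x y : ecardinal) : ecardinal :=
  if `[< ele x y >] then x else y.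
Definition emax (x y : ecardinal) : ecardinal :=
  if `[< ele x y >] then y else x.

(* The least size of a set F such that P F, and [None] if there is none. *)
Definition least_size (T : Type) (P : set T -> Prop) : ecardinal :=
  if pselect (exists F, P F)
  then Some (cmin (fun k => exists2 F : set T, P F & k = cardof F))
  else None.

(* [K]^{aleph_0}, ordered by inclusion in [add_ctbl] and [cof_ctbl]. *)
Definition ctbl_subsets (K : Type) : set (set K) := [set A | A #= [set: nat]].
Arguments ctbl_subsets : clear implicits.

Definition add_ctbl (k : cardinal) : ecardinal :=
  least_size (fun F : set (set (carrier k)) =>
    F `<=` ctbl_subsets (carrier k) /\
    ~ exists2 B, ctbl_subsets (carrier k) B & forall A, F A -> A `<=` B).

Definition cof_ctbl (k : cardinal) : ecardinal :=
  least_size (fun F : set (set (carrier k)) =>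
    F `<=` ctbl_subsets (carrier k) /\
    forall A, ctbl_subsets (carrier k) A -> exists2 B, F B & A `<=` B).

Definition nowhere_dense (T : topologicalType) (A : set T) : Prop :=
  interior (closure A) = set0.

Definition meager (T : topologicalType) (A : set T) : Prop :=
  exists2 N : nat -> set T, (forall n, nowhere_dense (N n)) & A = \bigcup_n N n.

Definition non_meager (R : realType) : ecardinal :=
  least_size (fun A : set R => ~ meager A).

Definition cov_meager (R : realType) : ecardinal :=
  least_size (fun C : set (set R) =>
    (forall A, C A -> meager A) /\ \bigcup_(A in C) A = [set: R]).

Section Localization.
Variables (b : nat -> Type) (h : nat -> nat).

Definition slaloms : set (forall n, set (b n)) :=
  [set phi | forall n, phi n #<= `I_(h n)].

Definition localizes (phi : forall n, set (b n)) (x : forall n, b n) : Prop :=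
  \forall n \near \oo, phi n (x n).

Definition anti_localizes (phi : forall n, set (b n)) (x : forall n, b n) :
  Prop :=
  finite_set [set n | phi n (x n)].

Definition bLc : ecardinal :=
  least_size (fun F : set (forall n, b n) =>
    ~ exists2 phi, slaloms phi & forall x, F x -> localizes phi x).

Definition dLc : ecardinal :=
  least_size (fun Phi : set (forall n, set (b n)) =>
    Phi `<=` slaloms /\ forall x, exists2 phi, Phi phi & localizes phi x).

Definition baLc : ecardinal :=
  least_size (fun Phi : set (forall n, set (b n)) =>
    Phi `<=` slaloms /\
    ~ exists y, forall phi, Phi phi -> anti_localizes phi y).

Definition daLc : ecardinal :=
  least_size (fun D : set (forall n, b n) =>
    forall phi, slaloms phi -> exists2 y, D y & anti_localizes phi y).

End Localization.

(* Main.v *)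
(* Each of the eight cardinals is the norm [dnum r] (least size of a dominating
   family) of a relation [r] or of its dual, so that both equations of (a), resp.
   of (b), come from the same Tukey connections. Write K for kappa or lambda, and
   [in_ctbl] for "the sequence a in K^omega is contained in the countable set B".

   Upper bounds: as |b(i)| <= K for infinitely many i (resp. almost all i), a
   countable subset of K covering the values of x in prod b reduces x to an
   element of omega^omega; thus the relation for b lies below the sequential
   composition of [in_ctbl] and the relation for omega.

   Lower bounds: the finite initial segments of a in K^omega are coded by elements
   of the b(i), so that a slalom catching the code yields a countable set
   containing a; hence [in_ctbl] lies below the relation for b. The relation for
   omega lies below the one for b as well; for localization this uses blocks of
   coordinates if h goes to infinity, and otherwise an independent family, which
   makes every slalom localize at most liminf h functions.

   It remains to prove Bartoszynski's characterization of non(M) and cov(M) by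
   infinitely often equal functions. *)
Require Import Defs.
From HB Require Import structures.
From mathcomp Require Import all_boot all_order all_algebra.
From mathcomp Require Import all_classical all_reals all_analysis.

Set Implicit Arguments.
Unset Strict Implicit.
Unset Printing Implicit Defensive.

Import numFieldNormedType.Exports.

Local Open Scope classical_set_scope.
Local Open Scope card_scope.

(** * Injections and infinite types *)

(** Choice turns the relation into an injection; cardinalities of sets can thus be compared without
    writing a function between their subtypes. *)
Lemma card_le_rel (T U : Type) (A : set T) (B : set U) (r : T -> U -> Prop) :
  (forall x, A x -> exists2 y, B y & r x y) ->
  (forall x x' y, A x -> A x' -> r x y -> r x' y -> x = x') -> A #<= B.
Proof.
move=> rex rinj.
have /choice[f fP] : forall x : A, exists y : B, r (val x) (val y).
  by move=> [x /= /set_mem /rex[y By rxy]]; exists (SigSub (mem_set By)).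
apply/card_leP/injfunPex; exists f => // x x' _ _ fE; apply: val_inj.
apply: (rinj _ _ (val (f x))); [exact: set_valP|exact: set_valP|exact: fP|].
by rewrite fE; exact: fP.
Qed.

Lemma card_le_typeP (A B : Type) :
  [set: A] #<= [set: B] <-> exists f : A -> B, injective f.
Proof.
split=> [/card_leP[f]|[f]]; last exact: inj_cle.
exists (fun x => val (f (SigSub (mem_set (I : [set: A] x))))) => x y.
by move=> /val_inj/inj; rewrite !inE => /(_ I I) [].
Qed.

Lemma card_le_IIP (T : Type) (A : set T) n :
  A #<= `I_n <->
  exists2 f : T -> nat, (forall x, A x -> (f x < n)%N) &
    forall x y, A x -> A y -> f x = f y -> x = y.
Proof.
split=> [/pcard_leP[f]|[f fn finj]].
  exists f => [x Ax|x y Ax Ay]; first exact: (@funS _ _ _ _ f).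
  by move=> /inj; apply; rewrite inE.
apply: (card_le_rel (r := fun x y => f x = y)) => [x Ax|x x' y Ax Ax' <- E].
  by exists (f x) => //; exact: fn.
by apply: finj.
Qed.

Lemma infinite_typeP (A : Type) :
  infinite_set [set: A] <-> exists f : nat -> A, injective f.
Proof. by rewrite infiniteP; exact: card_le_typeP. Qed.

Lemma infinite_natP (A : set nat) :
  infinite_set A <-> forall n, exists2 m, (n <= m)%N & A m.
Proof.
split=> [Ainf n|H].
  apply: contrapT => /forall2NP nA; apply: Ainf; apply: sub_finite_set (finite_II n).
  by move=> m Am /=; case: (nA m) => //; rewrite ltnNge => /negP.
move=> /finite_set_leP[k /card_le_IIP[f fk finj]].
(* Unboundedness gives duplicate-free lists in [A] of every length; one of length [k.+1] contradicts
   the injection into the numbers below [k]. *)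
have : forall s, exists2 t, uniq t & all (fun x => `[< A x >]) t /\ size t = s.
  elim=> [|s [t ut [At st]]]; first by exists [::].
  have [m mn Am] := H (\max_(x <- t) x).+1.
  exists (m :: t) => /=.
    rewrite ut andbT; apply/negP => mt.
    by have := leq_bigmax_seq (F := id) m mt isT; rewrite leqNgt mn.
  by split; [apply/andP; split => //; exact/asboolP|rewrite st].
move=> /(_ k.+1)[t ut [At st]].
have : uniq (map f t).
  rewrite map_inj_in_uniq// => x y xt yt; apply: finj; apply/asboolP.
    exact: (allP At x xt). exact: (allP At y yt).
move=> um; have : {subset map f t <= iota 0 k}.
  move=> _ /mapP[x xt ->]; rewrite mem_iota/= add0n; apply: fk.
  exact/asboolP/(allP At x xt).
by move/(uniq_leq_size um); rewrite size_map size_iota st ltnn.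
Qed.

Lemma infinite_nat_enum (A : set nat) :
  infinite_set A -> exists2 e : nat -> nat, injective e & forall k, A (e k).
Proof.
move=> /infiniteP/pcard_leP[f]; exists f => [x y /inj|k].
  by rewrite !inE; apply.
exact: (@funS _ _ _ _ f).
Qed.

Lemma inj_diverge (e : nat -> nat) n : injective e ->
  exists N, forall k, (N <= k)%N -> (n <= e k)%N.
Proof.
move=> einj; elim: n => [|n [N HN]]; first by exists 0.
have [[k ek]|nk] := pselect (exists k, e k = n).
  exists (maxn N k.+1) => l; rewrite geq_max => /andP[/HN nl kl].
  rewrite ltn_neqAle nl andbT; apply/eqP => E.
  by move: kl; rewrite (einj k l) ?ltnn// ek.
exists N => k /HN ?; rewrite ltn_neqAle; apply/andP; split => //.
by apply/eqP => E; apply: nk; exists k.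
Qed.

Lemma infinite_image_inj (e : nat -> nat) (A : set nat) :
  injective e -> infinite_set A -> infinite_set (e @` A).
Proof.
move=> einj /infinite_natP Ainf; apply/infinite_natP => n.
have [N HN] := inj_diverge n einj; have [m Nm Am] := Ainf N.
by exists (e m); [exact: HN|exists m].
Qed.

Lemma card_le_total (A B : Type) :
  (exists f : A -> B, injective f) \/ (exists f : B -> A, injective f).
Proof.
have [] := cle_total (cardof A) (cardof B) => /cle_cardof/card_le_typeP; auto.
Qed.

Lemma card_le_funP (T U : Type) (A : set T) (B : set U) (u0 : U) :
  A #<= B -> exists2 f : T -> U, (forall x, A x -> B (f x)) &
    forall x y, A x -> A y -> f x = f y -> x = y.
Proof.
move=> /card_leP[f].
exists (fun x => if pselect (A x) is left Ax then val (f (SigSub (mem_set Ax)))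
                 else u0) => [x Ax|x y Ax Ay].
  by case: pselect => // Ax'; exact: set_valP.
case: pselect => // Ax'; case: pselect => // Ay' /val_inj/inj.
by rewrite !inE => /(_ I I) [].
Qed.

(** * Hessenberg's theorem on squares of infinite types *)

Section Hessenberg.
Variable A : Type.
Implicit Types (G H : set (A * A * A)) (a b c : A).

Let dom G a := exists c, G (a, a, c).

(* [G] is the graph of an injection of [dom G * dom G] into [dom G]. *)
Let square_graph G :=
  [/\ forall a b c c', G (a, b, c) -> G (a, b, c') -> c = c',
      forall a b a' b' c, G (a, b, c) -> G (a', b', c) -> a = a' /\ b = b',
      forall a b, dom G a -> dom G b -> exists c, G (a, b, c)
    & forall a b c, G (a, b, c) -> [/\ dom G a, dom G b & dom G c]].

(** Each clause speaks of at most two triples of [U], so it is inherited from a square graph inside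
    [U] that contains both. *)
Let square_graph_directed U :
  (forall t1 t2, U t1 -> U t2 ->
    exists H, [/\ square_graph H, H `<=` U, H t1 & H t2]) -> square_graph U.
Proof.
move=> dirU; have domS H : H `<=` U -> dom H `<=` dom U.
  by move=> HU a [c /HU]; exists c.
split.
- move=> a b c c' /dirU/[apply] -[H [[fH _ _ _] _ H1 H2]]; exact: fH H1 H2.
- move=> a b a' b' c /dirU/[apply] -[H [[_ iH _ _] _ H1 H2]]; exact: iH H1 H2.
- move=> a b [c Uc] [d Ud]; have [H [[_ _ tH _] HU H1 H2]] := dirU _ _ Uc Ud.
  have [|e He] := tH a b _ (ex_intro _ d H2); first by exists c.
  by exists e; exact: HU.
- move=> a b c Uc; have [H [[_ _ _ sH] HU H1 _]] := dirU _ _ Uc Uc.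
  by have [] := sH _ _ _ H1; split; exact: domS HU _ _.
Qed.

Variables (i : nat -> A) (i_inj : injective i).

(** The pairing of natural numbers transported along [i]; a square graph containing it has an
    infinite domain. *)
Let G0 : set (A * A * A) :=
  [set t | exists m n, t = (i m, i n, i (pickle (m, n)))].

Let domG0 a : dom G0 a <-> exists n, a = i n.
Proof.
split=> [[c [m [n [-> _ _]]]]|[n ->]]; first by exists m.
by exists (i (pickle (n, n))), n, n.
Qed.

Let square_graph_G0 : square_graph G0.
Proof.
split.
- by move=> a b c c' [m [n [-> -> ->]]] [m' [n' [/i_inj <- /i_inj <- ->]]].
- move=> a b a' b' c [m [n [-> -> ->]]] [m' [n' [-> ->]]].
  by move=> /i_inj/(pcan_inj pickleK)[-> ->].
- by move=> a b /domG0[m ->] /domG0[n ->]; exists (i (pickle (m, n))), m, n.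
- by move=> a b c [m [n [-> -> ->]]]; split; apply/domG0; eexists.
Qed.

Let maximal_square_graph : exists H, [/\ square_graph H, G0 `<=` H &
  forall H', square_graph H' -> H `<=` H' -> H' `<=` H].
Proof.
(* Zorn is applied to the sets [G] whose union with [G0] is a square graph, so that the empty chain
   causes no exception. *)
have [|G [PG Gmax]] := @Zorn_bigcup _ (fun G => square_graph (G `|` G0)).
  move=> F FP Ftot; apply: square_graph_directed => t1 t2.
  have sub X : F X -> X `|` G0 `<=` \bigcup_(X in F) X `|` G0.
    by move=> FX t [Xt|]; [left; exists X|right].
  move=> [[X FX Xt]|Gt] [[Y FY Yt]|Gt'].
  - have [XY|YX] := Ftot _ _ FX FY.
      by exists (Y `|` G0); split; [exact: FP|exact: sub|left; exact: XY|left].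
    by exists (X `|` G0); split; [exact: FP|exact: sub|left|left; exact: YX].
  - by exists (X `|` G0); split; [exact: FP|exact: sub|left|right].
  - by exists (Y `|` G0); split; [exact: FP|exact: sub|right|left].
  - by exists G0; split => // t; right.
exists (G `|` G0); split => // H' sH' GH'.
apply: contrapT => nH'; apply: (Gmax H').
  split=> [t Gt|H'G]; first by apply: GH'; left.
  by apply: nH' => t /H'G; left.
rewrite (_ : H' `|` G0 = H')//; apply/seteqP; split=> t; last by left.
by case=> // G0t; apply: GH'; right.
Qed.

Lemma square_inj_nat : exists f : A * A -> A, injective f.
Proof.
have [H [sH G0H Hmax]] := maximal_square_graph.
have [fH iH tH rH] := sH.
pose S : set A := dom H.
have iS n : S (i n).
  by exists (i (pickle (n, n))); apply: G0H; exists n, n.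
have /choice[F FP] : forall ab : A * A, exists c, S ab.1 -> S ab.2 ->
    H (ab.1, ab.2, c).
  move=> [a b] /=; have [[Sa Sb]|nS] := pselect (S a /\ S b).
    by have [c Hc] := tH _ _ Sa Sb; exists c.
  by exists a => Sa Sb; case: nS.
have FS a b : S a -> S b -> S (F (a, b)).
  by move=> Sa Sb; have [] := rH _ _ _ (FP (a, b) Sa Sb).
have Finj a b a' b' : S a -> S b -> S a' -> S b' ->
    F (a, b) = F (a', b') -> a = a' /\ b = b'.
  move=> Sa Sb Sa' Sb' E; apply: (iH _ _ _ _ (F (a, b))); first exact: (FP (a, b)).
  by rewrite E; exact: (FP (a', b')).
(* If the complement of [S] injects into [S], then [A] injects into [S] by pairing with the tags
   [i 0] and [i 1], and [F] concludes. Otherwise a copy [u] of [S] outside [S] contradicts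
   maximality. *)
have [|] := card_le_total S (~` S); last first.
  move=> /card_le_typeP; rewrite (card_le_eql (card_setT _)).
  rewrite (card_le_eqr (card_setT _)) => /(card_le_funP (i 0))[v vS vinj].
  pose m a := if pselect (S a) is left _ then F (a, i 0) else F (v a, i 1).
  have mS a : S (m a) by rewrite /m; case: pselect => ?; apply: (FS) => //; exact: vS.
  have minj : injective m.
    move=> a b; rewrite /m; case: pselect => Sa; case: pselect => Sb.
    - by move/Finj => [].
    - by move=> /Finj[]//; [exact: vS|move=> _ /i_inj].
    - by move=> /Finj[]//; [exact: vS|move=> _ /i_inj].
    - by move=> /Finj[]//; [exact: vS|exact: vS|move=> /vinj-> ].
  by exists (fun ab => F (m ab.1, m ab.2)) => -[a b] [a' b'] /= /Finj[]// /minj-> /minj->.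
move=> /card_le_typeP; rewrite (card_le_eql (card_setT _)).
rewrite (card_le_eqr (card_setT _)) => /(card_le_funP (i 0))[u uS uinj].
exfalso.
(* [N] handles the pairs with at least one coordinate in the copy of [S]. The booleans say which
   ones, and [x + y.*2] separates these three kinds; the values lie in the copy, hence apart from
   those of [H]. *)
pose N : set (A * A * A) := [set t | exists s t' (x y : bool), [/\ S s, S t', x || y &
  t = (if x then u s else s, if y then u t' else t',
       u (F (F (s, t'), i (x + y.*2))))]].
have NC a b c : N (a, b, c) -> ~ S c.
  move=> [s [t [x [y [Ss St _ [_ _ ->]]]]]]; apply: uS.
  exact: (FS _ _ (FS _ _ _ _) (iS _)).
have NNS a b c : N (a, b, c) -> S a -> S b -> False.
  move=> [s [t [x [y [Ss St + [-> -> _]]]]]].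
  by case: x => /= [_ Sus _|-> _ Sut]; [case: (uS s)|case: (uS t)].
have Nu s : S s -> N (u s, u s, u (F (F (s, s), i (true + true.*2)))).
  by move=> Ss; exists s, s, true, true.
have domH' a : dom (H `|` N) a <-> S a \/ exists2 s, S s & a = u s.
  split=> [[c [Hc|[s [t [x [y [Ss St _ [-> _ _]]]]]]]]|[[c Hc]|[s Ss ->]]].
  - by left; exists c.
  - by case: (x); [right; exists s|left].
  - by exists c; left.
  - by eexists; right; exact: Nu.
have sH' : square_graph (H `|` N).
  split.
  - move=> a b c c' [Hc|Nc] [Hc'|Nc'].
    + exact: fH Hc Hc'.
    + by have [Sa Sb _] := rH _ _ _ Hc; case: (NNS _ _ _ Nc' Sa Sb).
    + by have [Sa Sb _] := rH _ _ _ Hc'; case: (NNS _ _ _ Nc Sa Sb).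
    + move: Nc Nc' => [s [t [x [y [Ss St _ [-> -> ->]]]]]].
      move=> [s' [t' [x' [y' [Ss' St' _ [+ + ->]]]]]].
      have aux (z z' : bool) w w' : S w -> S w' ->
          (if z then u w else w) = (if z' then u w' else w') -> z = z' /\ w = w'.
        move=> Sw Sw'; case: z; case: z' => E //.
        - by rewrite (uinj _ _ Sw Sw' E).
        - by case: (uS w) => //; rewrite E.
        - by case: (uS w') => //; rewrite -E.
      by move=> /(aux _ _ _ _ Ss Ss')[-> ->] /(aux _ _ _ _ St St')[-> ->].
  - move=> a b a' b' c [Hc|Nc] [Hc'|Nc'].
    + exact: iH Hc Hc'.
    + by case: (NC _ _ _ Nc'); have [] := rH _ _ _ Hc.
    + by case: (NC _ _ _ Nc); have [] := rH _ _ _ Hc'.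
    + move: Nc Nc' => [s [t [x [y [Ss St _ [-> -> ->]]]]]].
      move=> [s' [t' [x' [y' [Ss' St' _ [-> ->]]]]]].
      have FFS w w' n : S w -> S w' -> S (F (F (w, w'), i n)).
        by move=> Sw Sw'; by exact: (FS _ _ (FS _ _ _ _) (iS _)).
      move=> /uinj => /(_ (FFS _ _ _ Ss St) (FFS _ _ _ Ss' St')).
      move=> /(Finj _ _ _ _ (FS _ _ Ss St) (iS _) (FS _ _ Ss' St') (iS _))[].
      by move=> /Finj[]// -> -> /i_inj; case: x x' y y' => -[] [] [].
  - move=> a b /domH'[Sa|[s Ss ->]] /domH'[Sb|[t St ->]].
    + by have [c] := tH _ _ Sa Sb; exists c; left.
    + by eexists; right; exists a, t, false, true; split.
    + by eexists; right; exists s, b, true, false; split.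
    + by eexists; right; exists s, t, true, true; split.
  - move=> a b c [/rH[Sa Sb Sc]|[s [t [x [y [Ss St _ [-> -> ->]]]]]]].
      by split; apply/domH'; left.
    split; apply/domH'.
    + by case: (x); [right; exists s|left].
    + by case: (y); [right; exists t|left].
    + by right; eexists; last reflexivity; exact: (FS _ _ (FS _ _ _ _) (iS _)).
have HH' : H `<=` H `|` N by move=> t; left.
apply: (uS _ (iS 0)).
have := Hmax _ sH' HH' _ (or_intror (Nu _ (iS 0))).
by move=> Hc; exists (u (F (F (i 0, i 0), i (true + true.*2)))).
Qed.

End Hessenberg.

Lemma square_inj (A : Type) :
  infinite_set [set: A] -> exists f : A * A -> A, injective f.
Proof. by move=> /infinite_typeP[i /square_inj_nat]. Qed.

Lemma nat_prod_inj (A : Type) :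
  infinite_set [set: A] -> exists f : nat * A -> A, injective f.
Proof.
move=> Ainf; have [i i_inj] := (infinite_typeP A).1 Ainf.
have [f finj] := square_inj Ainf.
by exists (fun na => f (i na.1, na.2)) => -[n a] [m b] /finj[/i_inj-> ->].
Qed.

(** Iterated pairing is injective on lists of one length, so the length is coded alongside. *)
Lemma seq_inj (A : Type) :
  infinite_set [set: A] -> exists f : seq A -> A, injective f.
Proof.
move=> Ainf; have [i _] := (infinite_typeP A).1 Ainf.
have [f finj] := square_inj Ainf; have [g ginj] := nat_prod_inj Ainf.
pose code := foldr (fun a c => f (a, c)) (i 0).
exists (fun s => g (size s, code s)) => s t /ginj[].
by elim: s t => [|a s IHs] [|b t]//= [st] /finj[-> /IHs->].
Qed.

(** * Extended cardinals and Tukey connections *)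

Lemma cle_refl k : cle k k. Proof. exact: card_lexx. Qed.

Lemma cle_trans k l m : cle k l -> cle l m -> cle k m.
Proof. exact: card_le_trans. Qed.

Lemma cle_cardof_set (T U : Type) (A : set T) (B : set U) :
  cle (cardof A) (cardof B) <-> A #<= B.
Proof.
rewrite cle_cardof (card_le_eql (card_setT _)).
by rewrite (card_le_eqr (card_setT _)).
Qed.

Lemma cle_typeP (A B : Type) :
  cle (cardof A) (cardof B) <-> exists f : A -> B, injective f.
Proof. by rewrite cle_cardof; exact: card_le_typeP. Qed.

Lemma cle_carrierP k (B : Type) :
  cle k (cardof B) <-> exists f : carrier k -> B, injective f.
Proof. by rewrite -{1}(carrierK k); exact: cle_typeP. Qed.

Lemma carrier_cleP k (A : Type) :
  cle (cardof A) k <-> exists f : A -> carrier k, injective f.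
Proof. by rewrite -{1}(carrierK k); exact: cle_typeP. Qed.

Lemma ele_refl x : ele x x.
Proof. by case: x => //= k; exact: cle_refl. Qed.

Lemma ele_trans x y z : ele x y -> ele y z -> ele x z.
Proof. by case: x y z => [k|] [l|] [m|]//=; exact: cle_trans. Qed.

Lemma ele_anti x y : ele x y -> ele y x -> x = y.
Proof. by case: x y => [k|] [l|]//= kl lk; rewrite (cle_anti kl lk). Qed.

Lemma ele_total x y : ele x y \/ ele y x.
Proof.
by case: x y => [k|] [l|] /=; [exact: cle_total|left|right|left].
Qed.

Lemma emax_lub x y z : ele x z -> ele y z -> ele (emax x y) z.
Proof. by rewrite /emax; case: ifP. Qed.

Lemma emaxl x y : ele x (emax x y).
Proof. by rewrite /emax; case: asboolP => // _; exact: ele_refl. Qed.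

Lemma emaxr x y : ele y (emax x y).
Proof.
rewrite /emax; case: asboolP => [_|]; first exact: ele_refl.
by have [|] := ele_total x y.
Qed.

Lemma emin_glb x y z : ele z x -> ele z y -> ele z (emin x y).
Proof. by rewrite /emin; case: ifP. Qed.

Lemma eminl x y : ele (emin x y) x.
Proof.
rewrite /emin; case: asboolP => [_|]; first exact: ele_refl.
by have [|] := ele_total x y.
Qed.

Lemma eminr x y : ele (emin x y) y.
Proof. by rewrite /emin; case: asboolP => // _; exact: ele_refl. Qed.

Lemma emax_idPr x y : ele x y -> emax x y = y.
Proof. by rewrite /emax; case: asboolP. Qed.

Lemma emin_idPl x y : ele x y -> emin x y = x.
Proof. by rewrite /emin; case: asboolP. Qed.

Lemma eminNone y : emin None y = y.
Proof. by rewrite /emin; case: asboolP; case: y. Qed.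

Lemma eNonemax y : emax None y = None.
Proof. by rewrite /emax; case: asboolP; case: y. Qed.

Lemma emaxNone x : emax x None = None.
Proof. by rewrite /emax asboolT //; case: x. Qed.

Section LeastSize.
Variable T : Type.
Implicit Type P : set T -> Prop.

Lemma least_sizeP P :
  (exists F, [/\ P F, least_size P = Some (cardof F) &
     forall F', P F' -> F #<= F']) \/
  (least_size P = None /\ forall F, ~ P F).
Proof.
rewrite /least_size; case: pselect => [[F PF]|nP]; last first.
  by right; split=> // F PF; apply: nP; exists F.
left.
pose Q k := exists2 F : set T, P F & k = cardof F; rewrite -/Q.
have [|[G PG QG] min] := @cminP Q.
  by exists (cardof F), F.
exists G; split=> // [|F' PF']; first by rewrite QG.
by apply/cle_cardof_set; rewrite -QG; apply: min; exists F'.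
Qed.

Lemma least_size_le P (F : set T) :
  P F -> ele (least_size P) (Some (cardof F)).
Proof.
move=> PF; have [[G [PG -> min]]|[-> nP]] := least_sizeP P; last by case: (nP F).
by apply/cle_cardof_set/min.
Qed.

Lemma ele_least_size x P :
  (forall F, P F -> ele x (Some (cardof F))) -> ele x (least_size P).
Proof.
move=> xP; have [[G [PG -> _]]|[-> _]] := least_sizeP P; first exact: xP.
by case: x {xP}.
Qed.

End LeastSize.

Lemma le_least_size (T U : Type) (P : set T -> Prop) (Q : set U -> Prop) :
  (forall F, Q F -> exists2 F', P F' & F' #<= F) ->
  ele (least_size P) (least_size Q).
Proof.
move=> PQ; apply: ele_least_size => F /PQ[F' PF' F'F].
by apply: ele_trans (least_size_le PF') _; exact/cle_cardof_set.
Qed.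

Lemma le_least_size_image (T U : Type) (P : set T -> Prop) (Q : set U -> Prop)
    (f : U -> T) :
  (forall F, Q F -> P (f @` F)) -> ele (least_size P) (least_size Q).
Proof.
move=> PQ; apply: le_least_size => F QF; exists (f @` F); first exact: PQ.
exact: card_image_le.
Qed.

Definition dnum (X Y : Type) (r : X -> Y -> Prop) : ecardinal :=
  least_size (fun D : set Y => forall x, exists2 y, D y & r x y).

(** [dnum (dual r)] is the least size of an [r]-unbounded family, that is, of a set of [x] with no
    common [y]. *)
Definition dual (X Y : Type) (r : X -> Y -> Prop) (y : Y) (x : X) : Prop :=
  ~ r x y.

Definition tukey (X Y X' Y' : Type) (r : X -> Y -> Prop)
    (r' : X' -> Y' -> Prop) : Prop :=
  exists (f : X -> X') (g : Y' -> Y), forall x y, r' (f x) y -> r x (g y).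

Lemma tukey_trans (X Y X' Y' X'' Y'' : Type) (r : X -> Y -> Prop)
    (r' : X' -> Y' -> Prop) (r'' : X'' -> Y'' -> Prop) :
  tukey r r' -> tukey r' r'' -> tukey r r''.
Proof.
move=> [f [g fg]] [f' [g' fg']]; exists (f' \o f), (g \o g') => x y /= ?.
by apply: fg; exact: fg'.
Qed.

Lemma tukey_dual (X Y X' Y' : Type) (r : X -> Y -> Prop)
    (r' : X' -> Y' -> Prop) : tukey r r' -> tukey (dual r') (dual r).
Proof. by move=> [f [g fg]]; exists g, f => y x nr /fg. Qed.

Lemma tukey_dnum (X Y X' Y' : Type) (r : X -> Y -> Prop)
    (r' : X' -> Y' -> Prop) : tukey r r' -> ele (dnum r) (dnum r').
Proof.
move=> [f [g fg]]; apply: (le_least_size_image (f := g)) => D D' x.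
by have [y Dy ry] := D' (f x); exists (g y); [exists y|exact: fg].
Qed.

(* [r] is below the sequential composition of [r1] and [r2]. *)
Definition tukey_comp (X Y X1 Y1 X2 Y2 : Type) (r : X -> Y -> Prop)
    (r1 : X1 -> Y1 -> Prop) (r2 : X2 -> Y2 -> Prop) : Prop :=
  exists (f1 : X -> X1) (f2 : X -> Y1 -> X2) (g : Y1 -> Y2 -> Y),
    forall x y1 y2, r1 (f1 x) y1 -> r2 (f2 x y1) y2 -> r x (g y1 y2).

(** Used for the second factor of a composition: the product of two dominating families then has the
    size of the larger one. *)
Definition infinite_dnum (X Y : Type) (r : X -> Y -> Prop) : Prop :=
  forall D : set Y, (forall x, exists2 y, D y & r x y) -> infinite_set D.

Lemma infinite_card_leX (T U : Type) (A : set T) (B : set U) :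
  infinite_set B -> A #<= B -> A `*` B #<= B.
Proof.
move=> Binf AB.
have [|f finj] := @square_inj B.
  by rewrite infiniteP (card_le_eqr (card_setT B)) -infiniteP.
have [b _] := infinite_setN0 Binf.
have [g gB ginj] := card_le_funP b AB.
apply: (card_le_rel (r := fun ab c => exists (p q : B),
  [/\ val p = g ab.1, val q = ab.2 & c = val (f (p, q))])).
  move=> [a b'] [/= Aa Bb'].
  exists (val (f (SigSub (mem_set (gB _ Aa)), SigSub (mem_set Bb')))).
    exact: set_valP.
  by do 2 eexists; split; last reflexivity.
move=> [a b1] [a' b2] c [/= Aa Bb1] [/= Aa' Bb2] [p [q [/= pE qE ->]]].
move=> [p' [q' [pE' qE' /val_inj/finj[pp' qq']]]]; congr pair.
  by apply: ginj => //; rewrite -pE -pE' pp'.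
by rewrite -qE -qE' qq'.
Qed.

Lemma tukey_comp_dnum (X Y X1 Y1 X2 Y2 : Type) (r : X -> Y -> Prop)
    (r1 : X1 -> Y1 -> Prop) (r2 : X2 -> Y2 -> Prop) :
  infinite_dnum r2 -> tukey_comp r r1 r2 ->
  ele (dnum r) (emax (dnum r1) (dnum r2)).
Proof.
move=> inf2 [f1 [f2 [g fg]]].
rewrite /dnum; set P1 := (fun D : set Y1 => _); set P2 := (fun D : set Y2 => _).
have [[D1 [D1P D1E _]]|[-> _]] := least_sizeP P1; last first.
  by rewrite eNonemax; case: (least_size _).
have [[D2 [D2P D2E _]]|[-> _]] := least_sizeP P2; last first.
  by rewrite emaxNone; case: (least_size _).
rewrite D1E D2E; set D := (fun y => g y.1 y.2) @` (D1 `*` D2).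
have DP x : exists2 y, D y & r x y.
  have [y1 Dy1 ry1] := D1P (f1 x); have [y2 Dy2 ry2] := D2P (f2 x y1).
  by exists (g y1 y2); [exists (y1, y2)|exact: fg ry1 ry2].
apply: ele_trans (least_size_le DP) _.
have D2inf := inf2 _ D2P.
have [le12|le21] := ele_total (Some (cardof D1)) (Some (cardof D2)).
  rewrite emax_idPr//; apply/cle_cardof_set.
  apply: card_le_trans (card_image_le _ _) _.
  by apply: infinite_card_leX => //; exact/cle_cardof_set.
apply: ele_trans (emaxl _ _); apply/cle_cardof_set.
apply: card_le_trans (card_image_le _ _) _.
move/cle_cardof_set: le21 => le21.
have D1inf : infinite_set D1 by move: D2inf; rewrite !infiniteP => /card_le_trans; apply.
apply: card_le_trans (infinite_card_leX D1inf le21).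
apply: (card_le_rel (r := fun p q => p.1 = q.2 /\ p.2 = q.1)).
  by move=> [a b] [/= ? ?]; exists (b, a).
by move=> [a b] [a' b'] [c d] _ _ /= [-> ->] [-> ->].
Qed.

(** Given an [r]-unbounded [F], either no [y1] bounds its image under [f1], or some [y1] does and
    then its image under [f2 ^~ y1] is [r2]-unbounded. *)
Lemma tukey_comp_dual (X Y X1 Y1 X2 Y2 : Type) (r : X -> Y -> Prop)
    (r1 : X1 -> Y1 -> Prop) (r2 : X2 -> Y2 -> Prop) :
  tukey_comp r r1 r2 ->
  ele (emin (dnum (dual r1)) (dnum (dual r2))) (dnum (dual r)).
Proof.
move=> [f1 [f2 [g fg]]]; apply: ele_least_size => F FP.
have image_le (U : Type) (f : X -> U) : ele (Some (cardof (f @` F))) (Some (cardof F)).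
  exact/cle_cardof_set/card_image_le.
have [[y1 y1P]|/forallNP n1] := pselect (exists y1, forall x, F x -> r1 (f1 x) y1).
  apply: ele_trans (eminr _ _) _; apply: ele_trans _ (image_le _ (f2 ^~ y1)).
  apply: least_size_le => y2.
  have [x Fx nrx] := FP (g y1 y2); exists (f2 x y1); first by exists x.
  by move=> r2x; apply: nrx; apply: fg (y1P x Fx) r2x.
apply: ele_trans (eminl _ _) _; apply: ele_trans _ (image_le _ f1).
apply: least_size_le => y1.
have /existsNP[x /not_implyP[Fx nrx]] := n1 y1.
by exists (f1 x) => //; exists x.
Qed.

(** * The cardinals as norms of relations *)

Lemma dualK (X Y : Type) (r : X -> Y -> Prop) : dual (dual r) = r.
Proof. by apply/funext => x; apply/funext => y; rewrite /dual notK. Qed.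

(** Being a slalom is part of the relation, so that both sides range over full types and the notions
    of norm and dual apply directly. *)
Definition Lc (b : nat -> Type) (h : nat -> nat)
    (x : forall n, b n) (phi : forall n, set (b n)) : Prop :=
  slaloms h phi /\ localizes phi x.
Arguments Lc : clear implicits.

Definition aLc_dual (b : nat -> Type) (h : nat -> nat)
    (x : forall n, b n) (phi : forall n, set (b n)) : Prop :=
  slaloms h phi /\ ~ anti_localizes phi x.
Arguments aLc_dual : clear implicits.

Definition in_meager (T : topologicalType) (x : T) (A : set T) : Prop :=
  meager A /\ A x.

Definition in_ctbl (K : Type) (a : nat -> K) (B : set K) : Prop :=
  ctbl_subsets K B /\ forall n, B (a n).
Arguments in_ctbl : clear implicits.

Lemma dLcE b h : dLc b h = dnum (Lc b h).
Proof.
apply: ele_anti; apply: le_least_size => F FP.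
  exists (F `&` @slaloms b h); last exact/subset_card_le.
  split=> [phi []//|x]; have [phi Fphi [sphi lphi]] := FP x.
  by exists phi.
exists F; last exact: card_lexx.
move: FP => [Fsl FP] x; have [phi Fphi lphi] := FP x.
by exists phi => //; split => //; exact: Fsl.
Qed.

Lemma bLcE b h : bLc b h = dnum (dual (Lc b h)).
Proof.
rewrite /bLc /dnum; congr least_size; apply/funext => F; apply/propext; split.
  move=> /forall2NP nF phi; have [nsl|/existsNP[x /not_implyP[Fx nx]]] := nF phi.
    (* A sequence that is not a slalom is refuted by any member of [F]; there is one, since the
       empty slalom would localize an empty family. *)
    have [x Fx] : F !=set0.
      apply: contrapT => F0; case: (nF (fun=> set0)).
        by apply => n; exact: card_ge0.
      by apply => x Fx; case: F0; exists x.
    by exists x => // -[].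
  by exists x => // -[].
move=> FP [phi sphi lphi]; have [x Fx] := FP phi.
by apply; split=> //; exact: lphi.
Qed.

Lemma baLcE b h : baLc b h = dnum (aLc_dual b h).
Proof.
apply: ele_anti; apply: le_least_size => F FP.
  exists (F `&` @slaloms b h); last exact/subset_card_le.
  split=> [phi []//|[y yP]]; have [phi Fphi [sphi]] := FP y.
  by apply; exact: yP.
exists F; last exact: card_lexx.
move: FP => [Fsl nF] y; apply: contrapT => /forall2NP nphi.
apply: nF; exists y => phi Fphi; apply: contrapT => nal.
by case: (nphi phi) => // -[]; split => //; exact: Fsl.
Qed.

Lemma daLcE b h : daLc b h = dnum (dual (aLc_dual b h)).
Proof.
rewrite /daLc /dnum; congr least_size; apply/funext => F; apply/propext; split.
  move=> FP phi; have [sphi|nsphi] := pselect (slaloms h phi).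
    by have [y Fy al] := FP _ sphi; exists y => // -[_].
  (* The empty slalom provides a member of [F], which serves for every [phi] that is not a
     slalom. *)
  have [|y Fy _] := FP (fun=> set0); first by move=> n; exact: card_ge0.
  by exists y => // -[].
move=> FP phi sphi; have [y Fy nal] := FP phi; exists y => //.
by apply: contrapT => ?; apply: nal.
Qed.

Lemma meager0 (T : topologicalType) : meager (@set0 T).
Proof.
exists (fun=> set0) => [n|]; last by rewrite bigcup_const.
by rewrite /nowhere_dense closure0; exact: interior0.
Qed.

Lemma sub_meager (T : topologicalType) (A B : set T) :
  A `<=` B -> meager B -> meager A.
Proof.
move=> AB [N Nnd BE]; exists (fun n => N n `&` A) => [n|].
  rewrite /nowhere_dense -subset0 -(Nnd n); apply: interiorS.
  by apply: closure_subset => y [].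
rewrite -setI_bigcupl -BE; apply/seteqP; split=> x; last by case.
by move=> Ax; split => //; exact: AB.
Qed.

Lemma non_meagerE (R : realType) : non_meager R = dnum (dual (@in_meager R)).
Proof.
rewrite /non_meager /dnum; congr least_size; apply/funext => F.
apply/propext; split=> [nF A|FP mF].
  apply: contrapT => /forall2NP nx; apply: (nF).
  have [mA|nA] := pselect (meager A).
    apply: sub_meager mA => x Fx.
    by case: (nx x) => // /contrapT[].
  have -> : F = set0; last exact: meager0.
  apply/seteqP; split=> // x Fx; case: (nx x) => // /contrapT[mA].
  by case: nA.
by have [x Fx] := FP F; apply.
Qed.

Lemma cov_meagerE (R : realType) : cov_meager R = dnum (@in_meager R).
Proof.
apply: ele_anti; apply: le_least_size => F FP.
  exists (F `&` @meager R); last exact/subset_card_le.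
  split=> [A []//|]; apply/seteqP; split=> // x _.
  by have [A FA [mA Ax]] := FP x; exists A.
exists F; last exact: card_lexx.
move: FP => [mF FT] x; have : [set: R] x by [].
by rewrite -FT => -[A FA Ax]; exists A => //; split=> //; exact: mF.
Qed.

Lemma ctbl_subsetsP (K : Type) (B : set K) :
  ctbl_subsets K B <-> countable B /\ infinite_set B.
Proof.
rewrite /ctbl_subsets /= infiniteP; split=> [|[cB iB]].
  by rewrite card_eq_le => /andP[].
by rewrite card_eq_le; apply/andP; split.
Qed.

Lemma infinite_ctbl_subset (K : Type) :
  infinite_set [set: K] -> ctbl_subsets K !=set0.
Proof.
move=> /infinite_typeP[i i_inj]; exists (range i).
by rewrite /ctbl_subsets /=; apply: inj_card_eq => x y _ _ /i_inj.
Qed.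

Lemma ctbl_subsetsU (K : Type) (A B : set K) :
  ctbl_subsets K A -> countable B -> ctbl_subsets K (A `|` B).
Proof.
move=> /ctbl_subsetsP[cA iA] cB; apply/ctbl_subsetsP; split.
  by rewrite -bigcup2E; apply: bigcup_countable => // -[|[|n]] _ //=.
by apply: sub_infinite_set iA => x; left.
Qed.

Lemma countType_range (T : countType) (K : Type) (f : T -> K) :
  countable (range f).
Proof. by apply: card_le_trans (card_image_le _ _) _; exact: countableP. Qed.

Lemma ctbl_enum (K : Type) (A : set K) : ctbl_subsets K A ->
  exists2 a : nat -> K, injective a & A = range a.
Proof.
move=> cA; have [z0 _] : A !=set0 by apply: infinite_setN0; have /ctbl_subsetsP[] := cA.
have : [set: nat] #= A by rewrite card_eq_sym.
move=> /card_eqP[f].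
exists (fun n => val (f (SigSub (mem_set (I : [set: nat] n))))) => [m n|].
  by move=> /val_inj/inj; rewrite !inE => /(_ I I) [].
apply/seteqP; split=> [x Ax|_ [n _ <-]]; last exact: set_valP.
have [|[n nT] _ fn] := @surj _ _ setT setT f (SigSub (mem_set Ax)); first by [].
exists n => //; move: fn => /(congr1 val) /= <-.
by congr (val (f _)); exact: val_inj.
Qed.

(** A countably infinite set is the range of a sequence; conversely the range of a sequence,
    possibly finite, is padded with a fixed countably infinite [C]. *)
Lemma cof_ctblE k : infinite_set [set: carrier k] ->
  cof_ctbl k = dnum (in_ctbl (carrier k)).
Proof.
move=> kinf; have [C cC] := infinite_ctbl_subset kinf.
apply: ele_anti; apply: le_least_size => F FP.
  exists (F `&` ctbl_subsets (carrier k)); last exact/subset_card_le.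
  split=> [A []//|A /ctbl_enum[a _ ->]].
  have [B FB [cB aB]] := FP a.
  by exists B => // _ [n _ <-].
exists F; last exact: card_lexx.
move: FP => [cF FP] a.
have [|B FB aB] := FP (C `|` range a).
  exact/ctbl_subsetsU/countType_range.
by exists B => //; split=> [|n]; [exact: cF|apply: aB; right; exists n].
Qed.

Lemma add_ctblE k : infinite_set [set: carrier k] ->
  add_ctbl k = dnum (dual (in_ctbl (carrier k))).
Proof.
move=> kinf; have [C cC] := infinite_ctbl_subset kinf.
apply: ele_anti.
  apply: (le_least_size_image (f := fun a => C `|` range a)) => F FP.
  split=> [_ [a Fa <-]|[B cB BP]]; first exact/ctbl_subsetsU/countType_range.
  have [a Fa] := FP B; apply; split=> // n.
  by apply: (BP (C `|` range a)); [exists a|right; exists n].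
have /choice[e eP] : forall A : set (carrier k), exists a : nat -> carrier k,
    ctbl_subsets _ A -> A = range a.
  move=> A; have [/ctbl_enum[a _ ->]|nA] := pselect (ctbl_subsets _ A).
    by exists a.
  have [i _] := (infinite_typeP _).1 kinf.
  by exists i.
apply: (le_least_size_image (f := e)) => F [cF nF] B.
apply: contrapT => /forall2NP nB.
have {}nB A : F A -> ctbl_subsets _ B /\ A `<=` B.
  move=> FA; have [[]|/contrapT[cB aB]] := nB (e A); first by exists A.
  by split=> // x; rewrite (eP A (cF _ FA)) => -[n _ <-].
(* That [B] is countable is known only through a member of [F]; the empty family is bounded by [C]
   instead. *)
have [[A FA]|F0] := pselect (F !=set0).
  by apply: nF; exists B => [|A' /nB[]//]; have [] := nB _ FA.
by apply: nF; exists C => // A FA; case: F0; exists A.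
Qed.

(** * Infinitely often equal functions *)

Lemma card_le_infinite (T U : Type) (A : set T) (B : set U) :
  A #<= B -> infinite_set A -> infinite_set B.
Proof. by rewrite !infiniteP => AB /card_le_trans; apply. Qed.

Definition io_eq (f g : nat -> nat) : Prop :=
  infinite_set [set n | f n = g n].

Definition io_le (f g : nat -> nat) : Prop :=
  infinite_set [set n | (f n <= g n)%N].

(** Guessing on a prescribed infinite set: the first function enumerates the set, the second is the
    function to be guessed there. *)
Definition io_eq_on (ef : (nat -> nat) * (nat -> nat)) (g : nat -> nat) :
    Prop :=
  injective ef.1 -> infinite_set [set n | range ef.1 n /\ ef.2 n = g n].

Lemma io_le_tukey : tukey io_le io_eq.
Proof. by exists id, id => f g; apply: sub_infinite_set => n /= ->. Qed.

Lemma io_eq_tukey : tukey io_eq io_eq_on.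
Proof.
exists (fun f => (id, f)), id => f g /(_ (fun x y => id)).
by apply: sub_infinite_set => n [].
Qed.

(** The successor of the maximum of the first members at each argument eventually exceeds every
    member of a countable family. *)
Lemma infinite_dnum_io_le : infinite_dnum io_le.
Proof.
move=> D DP /finite_set_countable /pcard_injP[c c_inj].
pose g n := get [set y | D y /\ c y = n].
have [y Dy] := DP (fun n => (\max_(k < n.+1) g k n).+1); apply.
apply: sub_finite_set (finite_II (c y)) => n /= yn.
rewrite ltnNge; apply/negP => cn.
have gE : g (c y) = y.
  have [Dg cg] : [set y' | D y' /\ c y' = c y] (g (c y)) by apply: getPex; exists y.
  by apply: c_inj; rewrite ?inE.
move: cn; rewrite -ltnS => cn.
have := leq_bigmax (F := fun k : 'I_n.+1 => g k n) (Ordinal cn).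
by rewrite /= gE leqNgt; move: yn => ->.
Qed.

(** [g] follows the function of index [k] at all points [pickle (k, l)]. *)
Lemma countable_bounded_io_eq (F : set (nat -> nat)) :
  countable F -> exists g, forall f, F f -> io_eq f g.
Proof.
move=> /pcard_injP[c c_inj].
pose u n : nat -> nat := get [set y | F y /\ c y = n].
pose g n := if unpickle n is Some kl then u (kl : nat * nat).1 n else 0.
exists g => f Ff.
have uE : u (c f) = f.
  have [Fg cg] : [set y' | F y' /\ c y' = c f] (u (c f)) by apply: getPex; exists f.
  by apply: c_inj; rewrite ?inE.
apply: (@sub_infinite_set _ (range (fun l : nat => pickle (c f, l)))).
  by move=> _ [l _ <-]; rewrite /= /g pickleK uE.
apply: (infinite_image_inj (e := fun l => pickle (c f, l))) infinite_nat.
by move=> l l' /(pcan_inj pickleK) [].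
Qed.

(** Only [p] elements have been chosen before stage [p], so a list with more than [p] distinct
    entries still offers a new one. *)
Lemma greedy_choice (D : nat -> seq nat) : exists k : nat -> nat,
  forall p, (p < size (undup (D p)))%N ->
    k p \in D p /\ forall q, (q < p)%N -> k q <> k p.
Proof.
pose pick (prev : seq nat) p := head 0 [seq x <- D p | x \notin prev].
pose prev := fix prev n := if n is m.+1 then pick (prev m) m :: prev m else [::].
have szprev p : size (prev p) = p by elim: p => //= p ->.
have mem_prev q p : (q < p)%N -> pick (prev q) q \in prev p.
  elim: p => // p IHp; rewrite ltnS leq_eqVlt => /orP[/eqP->|/IHp].
    by rewrite /= mem_head.
  by rewrite /= inE => ->; rewrite orbT.
exists (fun p => pick (prev p) p) => p ltp.
have : pick (prev p) p \in [seq x <- D p | x \notin prev p].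
  rewrite /pick; case E : [seq x <- D p | x \notin prev p] => [|x s]; last first.
    by rewrite /= mem_head.
  exfalso; move: ltp; rewrite ltnNge => /negP; apply.
  rewrite -{2}(szprev p); apply: uniq_leq_size (undup_uniq _) _ => x.
  rewrite mem_undup => xD; apply/negPn/negP => nx.
  have : x \in [seq x <- D p | x \notin prev p] by rewrite mem_filter nx.
  by rewrite E.
rewrite mem_filter => /andP[nprev inD]; split=> // q qp E.
by move: nprev; rewrite -E mem_prev.
Qed.

(* A function is guessed together with sufficiently many of its arguments, so
   that arguments used by distinct guesses can be chosen pairwise distinct. *)
Lemma io_eq_on_tukey (h : nat -> nat) :
  tukey io_eq_on (aLc_dual (fun=> nat) h).
Proof.
(* The guess of rank [j] at coordinate [n] gets the position [pickle (n, j)]. [L n] exceeds all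
   these positions, so a table of [L n] distinct arguments meets the size condition of
   [greedy_choice]. *)
pose L n := (\max_(j < h n) pickle (n, nat_of_ord j)).+1.
pose tab (e f : nat -> nat) n := [seq (e t, f (e t)) | t <- iota 0 (L n)].
pose y (ef : (nat -> nat) * (nat -> nat)) n := pickle (tab ef.1 ef.2 n).
suff gex phi : exists g : nat -> nat, forall ef,
    aLc_dual (fun=> nat) h (y ef) phi -> io_eq_on ef g.
  by have [g gP] := choice gex; exists y, g => ef phi; exact: gP.
have [sphi|nsphi] := pselect (slaloms h phi); last by exists id => ef [].
have /choice[rho rhoP] : forall n, exists f : nat -> nat,
    (forall x, phi n x -> (f x < h n)%N) /\
    forall x x', phi n x -> phi n x' -> f x = f x' -> x = x'.
  by move=> n; have /card_le_IIP[f ? ?] := sphi n; exists f.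
pose guess p : seq (nat * nat) := xget [::] [set s | exists n j,
  [/\ p = pickle (n, j), phi n (pickle s) & rho n (pickle s) = j]].
pose D p := map fst (guess p).
have [k kP] := greedy_choice D.
pose good p := (p < size (undup (D p)))%N.
exists (fun x => xget 0 [set v | exists p,
  [/\ good p, k p = x & (x, v) \in guess p]]).
move=> [e f] [_ yinf] /= e_inj.
pose p n := pickle (n, rho n (y (e, f) n)).
have guessE n : phi n (y (e, f) n) -> guess (p n) = tab e f n.
  move=> phiy; rewrite /guess; case: xgetP => [s _|/(_ (tab e f n))]; last first.
    by case; exists n, (rho n (y (e, f) n)).
  move=> [n' [j [/(pcan_inj pickleK)[<- <-] phis /esym/(rhoP n).2]]].
  by move=> /(_ phiy phis)/(pcan_inj pickleK).
have goodp n : phi n (y (e, f) n) -> good (p n).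
  move=> phiy; rewrite /good /D guessE// undup_id.
    rewrite !size_map size_iota /L ltnS /p.
    exact: (leq_bigmax (F := fun j : 'I_(h n) => pickle (n, nat_of_ord j))
             (Ordinal ((rhoP n).1 _ phiy))).
  by rewrite -map_comp map_inj_uniq ?iota_uniq.
(* Distinct [n] have distinct positions [p n], hence distinct arguments [k (p n)] at which the guess
   is correct. *)
apply: card_le_infinite yinf.
apply: (card_le_rel (r := fun n x => k (p n) = x)).
  move=> n /= phiy; exists (k (p n)) => //.
  have := (kP _ (goodp _ phiy)).1; rewrite /D guessE// => /mapP[[x v] xv kE].
  have := xv => /mapP[t _ [xt vt]]; rewrite /= in kE.
  split; first by exists t => //; rewrite kE xt.
  case: xgetP => [w _ [q [gq kq wq]]|/(_ v)]; last first.
    by case; exists (p n); rewrite kE guessE//; split=> //; exact: goodp.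
  have qp : q = p n.
    have [lt|lt|//] := ltngtP q (p n).
      by have := (kP _ (goodp _ phiy)).2 _ lt.
    by have := (kP _ gq).2 _ lt; rewrite kq.
  move: wq; rewrite qp guessE// => /mapP[t' _ [kt' ->]].
  by rewrite kt'.
move=> n n' x /= phiy phiy' kx kx'; have knn' : k (p n) = k (p n') by rewrite kx.
have [lt|lt|/(pcan_inj pickleK)[]//] := ltngtP (p n) (p n').
  by have := (kP _ (goodp _ phiy')).2 _ lt.
by have := (kP _ (goodp _ phiy)).2 _ lt; rewrite knn'.
Qed.

(** * Meager sets of reals *)

Lemma nowhere_denseP (T : topologicalType) (N : set T) :
  nowhere_dense N <-> forall O, open O -> O !=set0 ->
    exists V, [/\ open V, V !=set0, V `<=` O & V `&` N = set0].
Proof.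
split=> [Nnd O oO O0|H].
  exists (O `\` closure N); split.
  - by rewrite setDE; apply: openI => //; exact/closed_openC/closed_closure.
  - apply: contrapT => /nonemptyPn OE; case: O0 => x Ox.
    have : (interior (closure N)) x.
      rewrite /interior; apply: filterS (open_nbhs_nbhs (conj oO Ox)) => y Oy.
      by apply: contrapT => nNy; have : (O `\` closure N) y by []; rewrite OE.
    by rewrite Nnd.
  - by move=> x [].
  - apply/seteqP; split=> // x [[_ nNx] Nx]; apply: nNx.
    exact: subset_closure.
apply/seteqP; split=> // x xN.
have [|V [oV [v Vv] VN VN0]] := H _ (@open_interior _ (closure N)); first by exists x.
have Nv : nbhs v V by apply: open_nbhs_nbhs.
have := interior_subset (VN _ Vv) V Nv.
by move=> [w [Nw Vw]]; rewrite -[set0 x]/(set0 w) -VN0.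
Qed.

Definition majorant (f : nat -> nat) n := n + \sum_(m < n.+1) f m.

Lemma majorant_mono f m n : m <= n -> majorant f m <= majorant f n.
Proof.
move=> mn; rewrite -(subnKC mn); elim: (n - m) => [|d IHd]; first by rewrite addn0.
rewrite addnS; apply: leq_trans IHd _; rewrite /majorant [X in _ <= _ + X]big_ord_recr.
by rewrite /= addSn ltnW// ltnS leq_add2l leq_addr.
Qed.

Lemma leq_majorant f n : n + f n <= majorant f n.
Proof. by rewrite /majorant big_ord_recr leq_add2l leq_addl. Qed.

(** Let [j] be [majorant g]. If the inequality fails from [n] on, then [j (n + t)] is at most the
    [t]-th iterate of [f] at [j n]. For some large [i] this gives
    [j i <= iter i f i <= g i < j i]. *)
Lemma majorant_growth (f g : nat -> nat) : (forall m n, m <= n -> f m <= f n) ->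
  (forall n, n <= f n) -> io_le (fun i => iter i f i) g ->
  infinite_set [set i | f (majorant g i) <= majorant g i.+1].
Proof.
move=> fmono fge /infinite_natP Hg; apply/infinite_natP => n.
apply: contrapT => /forall2NP H; pose j := majorant g.
have jlt t : j (n + t) <= iter t f (j n).
  elim: t => [|t IHt]; first by rewrite addn0.
  rewrite addnS /=; apply: leq_trans (fmono _ _ IHt).
  by case: (H (n + t)) => [|/negP]; rewrite ?leq_addr// -ltnNge => /ltnW.
have iter_mono t x y : x <= y -> iter t f x <= iter t f y.
  by move=> xy; elim: t => //= t; exact: fmono.
have iter_ge t d x : iter t f x <= iter (d + t) f x.
  by elim: d => //= d IHd; exact: leq_trans IHd (fge _).
have [i ige fi] := Hg (maxn n (j n)).+1.
have {}ige : [/\ n <= i, j n <= i & 0 < i].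
  move: ige; rewrite gtn_max => /andP[ni ji].
  by split; [exact: ltnW|exact: ltnW|exact: leq_ltn_trans ni].
case: ige => ni ji i0.
have := jlt (i - n); rewrite subnKC// leqNgt => /negP; apply.
apply: leq_ltn_trans (iter_mono (i - n) _ _ ji) _.
apply: leq_ltn_trans (iter_ge _ n _) _; rewrite subnKC//.
apply: leq_ltn_trans fi _; apply: leq_trans (leq_majorant _ _).
by rewrite -{1}[g i]add0n ltn_add2r.
Qed.

Section Reals.
Variable R : realType.

Import Order.TTheory GRing.Theory Num.Theory.
Local Open Scope ring_scope.

Lemma open_itv_sub (O : set R) : open O -> O !=set0 ->
  exists x e, 0 < e /\ `]x, (x + e)[ `<=` O.
Proof.
move=> oO [x Ox]; have /nbhs_ballP[e /= e0 eO] := open_nbhs_nbhs (conj oO Ox).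
exists x, e; split=> // y; rewrite /= in_itv/= => /andP[xy yxe].
apply: eO; rewrite /ball/= distrC ger0_norm ?subr_ge0 ?ltW//.
by rewrite ltrBlDl.
Qed.

(** For fixed [(q, N)] these intervals are pairwise disjoint and accumulate at [q] from the right,
    within distance [1 / (N + 1)]. *)
Let V (qN : rat * nat) (k : nat) : set R :=
  `]ratr qN.1 + (k + qN.2).+2%:R^-1, ratr qN.1 + (k + qN.2).+1%:R^-1[.

Let V_nonempty qN k : V qN k !=set0.
Proof.
exists ((ratr qN.1 + (k + qN.2).+2%:R^-1 + (ratr qN.1 + (k + qN.2).+1%:R^-1)) / 2).
rewrite /V /=; apply: mid_in_itvoo.
by rewrite ltrD2l ltf_pV2 ?posrE ?ltr0n// ltr_nat.
Qed.

Let V_le qN k k' x : V qN k x -> V qN k' x -> (k <= k')%N.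
Proof.
rewrite /V /= !in_itv/= => /andP[_ lt1] /andP[lt2 _].
have := lt_trans lt2 lt1; rewrite ltrD2l ltf_pV2 ?posrE ?ltr0n// ltr_nat.
by rewrite !ltnS leq_add2r.
Qed.

(* Every nonempty open set contains, for infinitely many [n], all of the
   disjoint intervals that make the [n]-th coordinate equal to [0, 1, 2, ...]. *)
Let coord (x : R) (n : nat) : nat :=
  xget 0%N [set k | exists2 qN : rat * nat, pickle qN = n & V qN k x].

(** The reals whose coordinates differ from [y] from [n] on form a nowhere dense set: every open set
    contains an interval on which some later coordinate takes the value prescribed by [y]. *)
Lemma io_eq_tukey_meager : tukey io_eq (dual (@in_meager R)).
Proof.
pose A y := [set x | ~ io_eq y (coord x)].
suff mA y : meager (A y).
  by exists A, coord => y x nyx; apply: contrapT => nE; apply: nyx.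
exists (fun n => [set x | forall m, (n <= m)%N -> y m <> coord x m]); last first.
  apply/seteqP; split=> x.
    move=> nE; apply: contrapT => nx; apply: nE; apply/infinite_natP => n.
    apply: contrapT => /forall2NP H; apply: nx; exists n => //= m nm.
    by case: (H m).
  move=> [n _ /= nx] /infinite_natP/(_ n)[m nm]; exact: nx.
move=> n; apply/nowhere_denseP => O oO O0.
have [x [e [e0 eO]]] := open_itv_sub oO O0.
have [q] := rat_in_itvoo (ltr_pwDr (divr_gt0 e0 (ltr0n _ 2)) (lexx x)).
rewrite in_itv/= => /andP[xq qe].
(* [N1] makes the coordinate at least [n]; [N2] makes the intervals at [q] short enough to stay
   below [x + e]. *)
have [N1 HN1] := @inj_diverge (fun N => pickle (q, N)) n
  (fun N N' E => congr1 snd (pcan_inj pickleK E)).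
have [N2 HN2] : exists N2 : nat, N2.+1%:R^-1 < e / 2.
  have e20 : 0 < e / 2 by rewrite divr_gt0.
  exists (Num.truncn (e / 2)^-1); rewrite -[ltRHS]invrK ltf_pV2 ?posrE ?invr_gt0//.
  by rewrite truncnS_gt.
pose N := maxn N1 N2.
exists (V (q, N) (y (pickle (q, N)))); split => //.
- move=> z; rewrite /V /= in_itv/= => /andP[lt1 lt2]; apply: eO.
  rewrite /= in_itv/=; apply/andP; split.
    by apply: lt_trans xq (lt_trans _ lt1); rewrite ltrDl invr_gt0 ltr0n.
  apply: lt_trans lt2 _; rewrite [e]splitr addrA; apply: ltrD => //.
  apply: le_lt_trans HN2; rewrite lef_pV2 ?posrE ?ltr0n// ler_nat ltnS.
  by apply: leq_trans (leq_addl _ _); rewrite leq_max leqnn orbT.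
- apply/seteqP; split=> // z [Vz /= /(_ (pickle (q, N)))]; apply.
    by apply: HN1; rewrite leq_max leqnn.
  rewrite /coord; case: xgetP => [k _ [qN /(pcan_inj pickleK) -> Vk]|].
    apply/eqP; rewrite eqn_leq; apply/andP.
    by split; [exact: V_le Vz Vk|exact: V_le Vk Vz].
  by move=> /(_ (y (pickle (q, N))))[]; exists (q, N).
Qed.

(** Enumerates the nondegenerate intervals with rational endpoints; the default [(0, 1)] keeps every
    code nondegenerate. *)
Let ends (k : nat) : R * R :=
  if unpickle k is Some qr then
    if (qr : rat * rat).1 < qr.2 then (ratr qr.1, ratr qr.2) else (0, 1)
  else (0, 1).

Let D k : set R := `[(ends k).1, (ends k).2].

Let ends_lt k : (ends k).1 < (ends k).2.
Proof.
rewrite /ends; case: unpickle => //= [[q r]]; case: ifP => //= qr.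
by rewrite ltr_rat.
Qed.

Let D_sub (O : set R) : open O -> O !=set0 -> exists k, D k `<=` O.
Proof.
move=> oO O0; have [x [e [e0 eO]]] := open_itv_sub oO O0.
have [r] := rat_in_itvoo (ltr_pwDr e0 (lexx x)).
rewrite in_itv/= => /andP[xr re].
have [q] := rat_in_itvoo xr; rewrite in_itv/= => /andP[xq qr].
exists (pickle (q, r)); rewrite /D /ends pickleK /= -(ltr_rat R) qr /=.
apply: subset_trans eO => z; rewrite /= !in_itv/= => /andP[qz zr].
by rewrite (lt_le_trans xq qz) (le_lt_trans zr re).
Qed.

Let D_avoid (N : set R) k : nowhere_dense N ->
  exists k', D k' `<=` D k /\ D k' `&` N = set0.
Proof.
move=> /nowhere_denseP/(_ `](ends k).1, (ends k).2[%classic) [].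
- exact: interval_open.
- exists (((ends k).1 + (ends k).2) / 2).
  exact/mid_in_itvoo/ends_lt.
- move=> W [oW W0 Wsub WN]; have [k' k'W] := D_sub oW W0.
  exists k'; split=> [z /k'W/Wsub|]; first exact: subset_itv_oo_cc.
  by apply/seteqP; split=> // z [/k'W Wz Nz]; rewrite -WN.
Qed.

Let D_avoid_seq (N : nat -> set R) n k : (forall m, nowhere_dense (N m)) ->
  exists k', D k' `<=` D k /\ forall m, (m <= n)%N -> D k' `&` N m = set0.
Proof.
move=> Nnd; elim: n => [|n [k' [k'k IH]]].
  by have [k' [? ?]] := D_avoid k (Nnd 0%N); exists k'; split=> // m; case: m.
have [k'' [k''k' Hn]] := D_avoid k' (Nnd n.+1); exists k''; split.
  exact: subset_trans k'k.
move=> m; rewrite leq_eqVlt => /orP[/eqP->//|/IH mE].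
by apply/seteqP; split=> // z [/k''k' ? ?]; rewrite -mE.
Qed.

(** The supremum of the left endpoints is below every right endpoint. *)
Let nested_D (c : nat -> nat) : (forall i, D (c i.+1) `<=` D (c i)) ->
  exists x, forall i, D (c i) x.
Proof.
move=> cS; have cle i j : (i <= j)%N -> D (c j) `<=` D (c i).
  move=> ij; rewrite -(subnKC ij); elim: (j - i)%N => [|d IHd]; first by rewrite addn0.
  by rewrite addnS; exact: subset_trans (cS _) IHd.
have lo_in i j : (i <= j)%N -> D (c i) (ends (c j)).1.
  by move=> ij; apply: (cle _ _ ij); rewrite /D /= in_itv/= lexx ltW.
pose E := range (fun i => (ends (c i)).1).
have Eub j : ubound E (ends (c j)).2.
  move=> _ [i _ <-]; have := lo_in _ _ (leq_maxr i j).
  have := lo_in _ _ (leq_maxl i j).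
  rewrite /D /= !in_itv/= => /andP[le1 _] /andP[_ le2].
  exact: le_trans le1 le2.
have E0 : E !=set0 by exists (ends (c 0%N)).1, 0%N.
exists (sup E) => i; rewrite /D /= in_itv/=; apply/andP; split.
  by apply: ub_le_sup; [exists (ends (c 0%N)).2; exact: Eub|exists i].
by apply: ge_sup => //; exact: Eub.
Qed.

Local Close Scope ring_scope.

(* Along the stages [j 0 <= j 1 <= ...] given by the first function, the second
   one guesses infinitely often how to shrink all the intervals [D k] with
   [k <= j i] so as to avoid the first [j i] nowhere dense sets. *)
Lemma meager_tukey_comp : tukey_comp (dual (@in_meager R)) io_le io_eq_on.
Proof.
have /choice[s sP] : forall A : set R, exists s : nat -> nat -> nat, meager A ->
    exists2 N : nat -> set R, A = \bigcup_n N n &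
      forall n k, D (s n k) `<=` D k /\
        forall m, m <= n -> D (s n k) `&` N m = set0.
  move=> A; have [[N Nnd AE]|nA] := pselect (meager A); last by exists (fun=> id).
  have /choice[s sP] : forall nk : nat * nat, exists k', D k' `<=` D nk.2 /\
      forall m, m <= nk.1 -> D k' `&` N m = set0.
    by move=> [n k]; exact: D_avoid_seq.
  by exists (fun n k => s (n, k)) => _; exists N => // n k; exact: (sP (n, k)).
(* [fA A n] bounds the codes obtained by shrinking the intervals of code at most [n]; it is
   monotone, as [majorant_growth] asks. *)
pose fA A := majorant (fun n => \max_(k < n.+1) s A n k).
have fA_mono A m n : m <= n -> fA A m <= fA A n by exact: majorant_mono.
have fA_ge A n : n <= fA A n by exact: leq_trans (leq_addr _ _) (leq_majorant _ _).
(* The stages at which such a shrinking stays within the bound of the next stage; guessing is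
   requested only there. *)
pose X A g := [set i | fA A (majorant g i) <= majorant g i.+1].
have /choice[e eP] : forall Ag : set R * (nat -> nat), exists e : nat -> nat,
    infinite_set (X Ag.1 Ag.2) -> injective e /\ forall k, X Ag.1 Ag.2 (e k).
  move=> [A g]; have [/infinite_nat_enum[e ? ?]|nX] := pselect (infinite_set (X A g)).
    by exists e.
  by exists id.
pose v A g i := pickle (mkseq (s A (majorant g i)) (majorant g i).+1).
(* A guess is followed only if it gives a subinterval whose code is within the next stage. The
   intervals are thus nested, and [c i] is at most the stage [i], for arbitrary [g1] and [g2]. *)
pose next g1 (g2 : nat -> nat) i c :=
  let k' := nth 0 (odflt [::] (unpickle (g2 i)) : seq nat) c in
  if (k' <= majorant g1 i.+1) && `[< D k' `<=` D c >] then k' else c.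
pose c g1 g2 := fix c i := if i is i'.+1 then next g1 g2 i' (c i') else 0.
have cS g1 g2 i : D (c g1 g2 i.+1) `<=` D (c g1 g2 i).
  by rewrite /= /next; case: ifP => [/andP[_ /asboolP]|_ z].
have c_le g1 g2 i : c g1 g2 i <= majorant g1 i.
  elim: i => // i IHi /=; rewrite /next; case: ifP => [/andP[]//|_].
  exact/(leq_trans IHi)/majorant_mono.
have /choice[x xP] : forall g : (nat -> nat) * (nat -> nat), exists x,
    forall i, D (c g.1 g.2 i) x by move=> g; exact: nested_D.
exists (fun A i => iter i (fA A) i), (fun A g => (e (A, g), v A g)).
exists (fun g1 g2 => x (g1, g2)) => A g1 g2 H1 H2 [mA].
have Xinf : infinite_set (X A g1) by apply: majorant_growth => //; exact: fA_mono.
have [e_inj eX] := eP (A, g1) Xinf.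
have [N AE sN] := sP A mA; rewrite {1}AE => -[m _ Nx].
have /infinite_natP/(_ m)[n mn [[t _ tn] vn]] := H2 e_inj.
have Xn : X A g1 n by rewrite -tn; exact: eX.
have mj : m <= majorant g1 n.
  exact: leq_trans mn (leq_trans (leq_addr _ _) (leq_majorant _ _)).
have [sD sNm] := sN (majorant g1 n) (c g1 g2 n).
have cn : c g1 g2 n.+1 = s A (majorant g1 n) (c g1 g2 n).
  have {}vn : g2 n = pickle (mkseq (s A (majorant g1 n)) (majorant g1 n).+1).
    by rewrite -vn.
  rewrite [LHS]/= /next vn pickleK [odflt _ _]/= nth_mkseq ?ltnS//.
  rewrite ifT//; apply/andP; split; last exact/asboolP.
  apply: leq_trans Xn; apply: leq_trans (leq_majorant _ _).
  apply: leq_trans (leq_addl _ _).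
  have lt : c g1 g2 n < (majorant g1 n).+1 by rewrite ltnS.
  exact: (leq_bigmax (F := fun k : 'I_(majorant g1 n).+1 => s A (majorant g1 n) k)
    (Ordinal lt)).
have : (D (s A (majorant g1 n) (c g1 g2 n)) `&` N m) (x (g1, g2)).
  by split=> //; rewrite -cn; exact: (xP (g1, g2)).
by rewrite sNm.
Qed.

End Reals.

(** * Slaloms *)

Lemma near_natP (P : nat -> Prop) :
  (\forall n \near \oo, P n) <-> exists N, forall n, (N <= n)%N -> P n.
Proof. by split=> [[N _ H]|[N H]]; [exists N|exists N]. Qed.

Lemma infinite_near (A P : set nat) :
  (\forall n \near \oo, P n) -> infinite_set A -> infinite_set (A `&` P).
Proof.
move=> /near_natP[N NP] /infinite_natP Ainf; apply/infinite_natP => n.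
have [m] := Ainf (maxn n N); rewrite geq_max => /andP[nm Nm] Am.
by exists m => //; split=> //; exact: NP.
Qed.

Lemma eventually_forall_lt (P : nat -> nat -> Prop) m :
  (forall j, (j < m)%N -> exists N, forall n, (N <= n)%N -> P j n) ->
  exists N, forall j n, (j < m)%N -> (N <= n)%N -> P j n.
Proof.
elim: m => [|m IHm] H; first by exists 0.
have [j jm|N1 H1] := IHm; first exact/H/ltnW.
have [N2 H2] := H m (ltnSn m).
exists (maxn N1 N2) => j n; rewrite ltnS geq_max => jm /andP[N1n N2n].
by move: jm; rewrite leq_eqVlt => /orP[/eqP->|jm]; [exact: H2|exact: H1].
Qed.

Lemma infinite_embedding (T : Type) : [set: T] !=set0 ->
  exists i : nat -> T, infinite_set [set: T] -> injective i.
Proof.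
move=> [t _]; have [/infinite_typeP[i i_inj]|nT] := pselect (infinite_set [set: T]).
  by exists i.
by exists (fun=> t).
Qed.

Lemma aLc_dual_nat_tukey (b : nat -> Type) (h : nat -> nat) :
  (forall i, [set: b i] !=set0) ->
  (\forall i \near \oo, infinite_set [set: b i]) ->
  tukey (aLc_dual (fun=> nat) h) (aLc_dual b h).
Proof.
move=> b0 binf.
pose iota i := sval (cid (infinite_embedding (b0 i))).
have iota_inj i : infinite_set [set: b i] -> injective (iota i).
  by rewrite /iota; case: cid.
exists (fun y i => iota i (y i)).
(* The slalom is pulled back along [iota i]; it is made empty where [b i] is finite, as [iota i]
   need not be injective there. *)
exists (fun phi i => [set v | infinite_set [set: b i] /\ phi i (iota i v)]).
move=> y phi [sphi yphi]; split=> [i|].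
  apply: card_le_trans (sphi i).
  apply: (card_le_rel (r := fun v z => iota i v = z)) => [v [_ pv]|].
    by exists (iota i v).
  by move=> v v' z [bi _] _ <- /(iota_inj i bi).
by apply: sub_infinite_set (infinite_near binf yphi) => n [].
Qed.

(** * Countable sets read off from slaloms *)

Section CountableCover.
Variables (b : nat -> Type) (h : nat -> nat) (K : Type).
Hypothesis b_neq0 : forall i, [set: b i] !=set0.
Hypothesis Kinf : infinite_set [set: K].
Variables (Ks : nat -> set K) (u : forall i, K -> b i).
Hypothesis u_inj : forall i z z', Ks i z -> Ks i z' -> u i z = u i z' -> z = z'.
Hypothesis Ks_inf : forall i z, Ks i z -> infinite_set [set: b i].

Let z0 : K := sval (cid ((infinite_typeP K).1 Kinf)) 0.

Let seq_in (A : set K) (s : seq K) :=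
  forall m, (m < size s)%N -> A (nth z0 s m).

(** Letters are sent to [b i] by [u i], and lists over an infinite [b i] are coded by [seq_inj]. If
    [b i] is finite, then [Ks i] is empty and the empty list is the only one to code. *)
Let code_ex i : exists c : seq K -> b i, forall s t,
  seq_in (Ks i) s -> seq_in (Ks i) t -> c s = c t -> s = t.
Proof.
have [d _] := b_neq0 i.
have [/seq_inj[c c_inj]|nb] := pselect (infinite_set [set: b i]).
  exists (c \o map (u i)) => s t sK tK /c_inj E.
  have szE : size s = size t by have := congr1 size E; rewrite !size_map.
  apply: (@eq_from_nth _ z0) => // m ms.
  apply: u_inj; [exact: sK|by apply: tK; rewrite -szE|].
  have := congr1 (fun s => nth d s m) E.
  by rewrite !(nth_map z0) // -szE.
exists (fun=> d) => s t sK tK _.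
case: s sK => [_|z s /(_ 0 isT)/Ks_inf//].
by case: t tK => [//|z t /(_ 0 isT)/Ks_inf//].
Qed.

Let code i := sval (cid (code_ex i)).

Let code_inj i s t : seq_in (Ks i) s -> seq_in (Ks i) t ->
  code i s = code i t -> s = t.
Proof. by rewrite /code; case: cid => c /= + ? ?; apply. Qed.

Let initial (a : nat -> K) i :=
  [seq a k | k <- iota 0 i & `[< Ks i (a k) >]].

Let initial_in a i : seq_in (Ks i) (initial a i).
Proof.
move=> m; rewrite size_map => ms; rewrite (nth_map 0)//.
by have := mem_nth 0 ms; rewrite mem_filter => /andP[/asboolP].
Qed.

Let B0 (phi : forall i, set (b i)) : set K := [set z | exists i s m,
  [/\ phi i (code i s), seq_in (Ks i) s, (m < size s)%N & z = nth z0 s m]].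

(** A list caught at [i] is determined by the rank of its code in [phi i], so its letters are
    indexed by triples of coordinate, rank and position. *)
Let B0_countable phi : slaloms h phi -> countable (B0 phi).
Proof.
move=> sphi.
have rho_ex i : exists f : b i -> nat, forall x x', phi i x -> phi i x' ->
    f x = f x' -> x = x'.
  by have /card_le_IIP[f _ f_inj] := sphi i; exists f.
pose rho i := sval (cid (rho_ex i)).
have rho_inj i x x' : phi i x -> phi i x' -> rho i x = rho i x' -> x = x'.
  by rewrite /rho; case: cid => f /= + ? ?; apply.
have /choice[S SP] : forall ik : nat * nat, exists s0, forall s,
    phi ik.1 (code ik.1 s) -> seq_in (Ks ik.1) s ->
    rho ik.1 (code ik.1 s) = ik.2 -> s = s0.
  move=> [i k] /=.
  have [[s0 [phis0 sK0 rs0]]|nex] := pselect (exists s0,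
    [/\ phi i (code i s0), seq_in (Ks i) s0 & rho i (code i s0) = k]); last first.
    by exists [::] => s ? ? ?; case: nex; exists s.
  exists s0 => s phis sK rs; apply: (@code_inj i) => //.
  by apply: rho_inj => //; rewrite rs.
pose T (t : nat * nat * nat) : K := nth z0 (S t.1) t.2.
suff sub : B0 phi `<=` range T.
  exact: sub_countable (subset_card_le sub) (countType_range T).
move=> z [i [s [m [phis sK ms ->]]]].
exists (i, rho i (code i s), m) => //; rewrite /T /=.
by rewrite -(SP (i, rho i (code i s)) s).
Qed.

Let B0_mem phi a k i : phi i (code i (initial a i)) -> (k < i)%N ->
  Ks i (a k) -> B0 phi (a k).
Proof.
move=> phia ki Ka; pose l := [seq k <- iota 0 i | `[< Ks i (a k) >]].
have kl : k \in l by rewrite mem_filter mem_iota ki /= andbT; exact/asboolP.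
exists i, (initial a i), (index k l); split=> //.
  by rewrite size_map index_mem.
by rewrite (nth_map 0) ?index_mem// nth_index.
Qed.

(** Pads [B0], which may be finite, to a countably infinite set. *)
Let C := sval (cid (infinite_ctbl_subset Kinf)).

Let in_ctbl_B0 phi a : slaloms h phi ->
  (forall k, exists i, [/\ (k < i)%N, Ks i (a k) & phi i (code i (initial a i))]) ->
  in_ctbl K a (C `|` B0 phi).
Proof.
move=> sphi Ha; split=> [|k].
  by apply: ctbl_subsetsU (B0_countable sphi); rewrite /C; case: cid.
by right; have [i [ki Ka pa]] := Ha k; exact: B0_mem pa ki Ka.
Qed.

(** The codes are caught infinitely often, so a point lying in almost all [Ks i] is a letter of some
    caught code. *)
Lemma in_ctbl_tukey_aLc_dual : (forall z, \forall i \near \oo, Ks i z) ->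
  tukey (in_ctbl K) (aLc_dual b h).
Proof.
move=> Knear; exists (fun a i => code i (initial a i)), (fun phi => C `|` B0 phi).
move=> a phi [sphi /infinite_natP aphi]; apply: in_ctbl_B0 => // k.
have /near_natP[N HN] := Knear (a k).
have [i] := aphi (maxn k.+1 N); rewrite geq_max => /andP[ki /HN ?] ?.
by exists i.
Qed.

(** Here almost all codes are caught, so it suffices that each point lies in infinitely many
    [Ks i]. *)
Lemma in_ctbl_tukey_Lc : (forall z, infinite_set [set i | Ks i z]) ->
  tukey (in_ctbl K) (Lc b h).
Proof.
move=> Kinfn; exists (fun a i => code i (initial a i)), (fun phi => C `|` B0 phi).
move=> a phi [sphi /near_natP[N HN]]; apply: in_ctbl_B0 => // k.
have /infinite_natP/(_ (maxn k.+1 N))[i] := Kinfn (a k).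
by rewrite geq_max => /andP[ki /HN ?] ?; exists i.
Qed.

End CountableCover.

Lemma rank_exists (K : Type) : exists rho : set K -> K -> nat,
  forall B x y, ctbl_subsets K B -> B x -> B y -> rho B x = rho B y -> x = y.
Proof.
have /choice[rho rhoP] : forall B : set K, exists f : K -> nat,
    ctbl_subsets K B -> forall x y, B x -> B y -> f x = f y -> x = y.
  move=> B; have [cB|nB] := pselect (ctbl_subsets K B); last by exists (fun=> 0).
  have /ctbl_subsetsP[/pcard_injP[f f_inj] _] := cB.
  by exists f => _ x y Bx By; apply: f_inj; rewrite inE.
by exists rho => B x y cB; exact: rhoP.
Qed.

(** On the coordinates [e k] a value of [y] is determined by its rank in the countable set [B];
    guessing the ranks gives a slalom with at most one element per coordinate. *)
Lemma aLc_dual_tukey_comp (b : nat -> Type) (h : nat -> nat) (K : Type)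
    (v : forall i, b i -> K) :
  infinite_set [set i | injective (v i) /\ (1 <= h i)%N] ->
  tukey_comp (aLc_dual b h) (in_ctbl K) io_eq.
Proof.
move=> /infinite_nat_enum[e e_inj eP]; have [rho rhoP] := rank_exists K.
exists (fun y k => v (e k) (y (e k))).
exists (fun y B k => rho B (v (e k) (y (e k)))).
exists (fun B s i => [set z : b i | exists k,
  [/\ e k = i, B (v i z) & rho B (v i z) = s k]]).
move=> y B s [cB yB] ys; split=> [i|].
  apply: (card_le_rel (r := fun _ n => n = 0)).
    by move=> z [k [ki _ _]]; exists 0 => //=; have [_] := eP k; rewrite ki.
  move=> z z' _ [k [ki Bz rz]] [k' [ki' Bz' rz']] _ _.
  have kk' : k = k' by apply: e_inj; rewrite ki.
  have [v_inj _] := eP k; rewrite ki in v_inj; apply: v_inj.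
  by apply: rhoP Bz Bz' _ => //; rewrite rz rz' kk'.
apply: sub_infinite_set (infinite_image_inj e_inj ys) => _ [k /= ks <-].
by exists k.
Qed.

(** Within the countable set [B], values are replaced by their ranks, and a slalom for the ranks is
    pulled back. It is empty before [N], where [v i] may fail to be injective. *)
Lemma Lc_tukey_comp (b : nat -> Type) (h : nat -> nat) (K : Type)
    (v : forall i, b i -> K) :
  (\forall i \near \oo, injective (v i)) ->
  tukey_comp (Lc b h) (in_ctbl K) (Lc (fun=> nat) h).
Proof.
move=> /near_natP[N vN]; have [rho rhoP] := rank_exists K.
exists (fun x i => v i (x i)), (fun x B i => rho B (v i (x i))).
exists (fun B psi i => [set z : b i | [/\ (N <= i)%N, B (v i z) &
  psi i (rho B (v i z))]]).
move=> x B psi [cB xB] [spsi /near_natP[M xM]]; split=> [i|].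
  apply: card_le_trans (spsi i).
  apply: (card_le_rel (r := fun z n => rho B (v i z) = n)).
    by move=> z [_ _ ?]; exists (rho B (v i z)).
  move=> z z' _ [Ni Bz _] [_ Bz' _] <- E; apply: (vN i Ni).
  exact/esym/rhoP/E.
apply/near_natP; exists (maxn N M) => i; rewrite geq_max => /andP[Ni Mi].
by split=> //; exact: xM.
Qed.

(** * Localization for omega below localization for b *)

Section LocalizationNat.
Variables (b : nat -> Type) (h : nat -> nat).
Hypothesis b_neq0 : forall i, [set: b i] !=set0.

Lemma Lc_nat_tukey_unbounded :
  infinite_set [set i | infinite_set [set: b i]] ->
  (forall m, \forall i \near \oo, (m <= h i)%N) ->
  tukey (Lc (fun=> nat) h) (Lc b h).
Proof.
move=> /infinite_natP binf hinf.
pose iota i := sval (cid (infinite_embedding (b_neq0 i))).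
have iota_inj i : infinite_set [set: b i] -> injective (iota i).
  by rewrite /iota; case: cid.
(* The value [x i] will be read off from the slalom at the largest valid coordinate [a i]; the
   condition on [h] makes that slalom small enough for [i]. *)
pose valid i a := [/\ (a <= i)%N, infinite_set [set: b a] & (h a <= h i)%N].
have /choice[a aP] : forall i, exists a, forall a', valid i a' ->
    valid i a /\ (a' <= a)%N.
  move=> i; have [ex|nex] := pselect (exists a, `[< valid i a >]); last first.
    by exists 0 => a' va'; case: nex; exists a'; exact/asboolP.
  have ub a : `[< valid i a >] -> (a <= i)%N by move=> /asboolP[].
  case: (ex_maxnP ex ub) => a /asboolP va amax.
  by exists a => a' va'; split=> //; apply: amax; exact/asboolP.
(* Past [M n] all [a i] exceed [n], so a prefix of length [M n] contains every [x i] with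
   [a i = n]. *)
have /choice[M MP] : forall n, exists M, forall i, (M <= i)%N ->
    valid i (a i) /\ (n < a i)%N.
  move=> n; have [a0 na0 ba0] := binf n.+1.
  have /near_natP[N HN] := hinf (h a0).
  exists (maxn a0 N) => i; rewrite geq_max => /andP[a0i /HN ha0].
  have [va le] := aP i a0 (And3 a0i ba0 ha0).
  by split=> //; exact: leq_trans le.
exists (fun x n => iota n (pickle (mkseq x (M n)))).
exists (fun phi i => [set v | valid i (a i) /\
  exists2 s : seq nat, phi (a i) (iota (a i) (pickle s)) & v = nth 0 s i]).
move=> x phi [sphi /near_natP[N HN]]; split=> [i|].
  have [[_ ba ha]|nv] := pselect (valid i (a i)); last first.
    rewrite (_ : [set v | _] = set0); first exact: card_ge0.
    by apply/seteqP; split=> // v [].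
  apply: (@card_le_trans _ _ _ `I_(h (a i))); last by rewrite card_le_II.
  apply: card_le_trans (sphi (a i)).
  apply: (card_le_rel (r := fun v z => exists2 s : seq nat,
      z = iota (a i) (pickle s) & v = nth 0 s i)).
    by move=> v [_ [s ps vs]]; exists (iota (a i) (pickle s)) => //; exists s.
  move=> v v' z _ _ [s -> ->] [s' /(iota_inj _ ba)/(pcan_inj pickleK) -> ->].
  by [].
apply/near_natP; exists (M N) => i Mi; have [va Na] := MP N i Mi.
split=> //; exists (mkseq x (M (a i))); first exact/HN/ltnW.
rewrite nth_mkseq// ltnNge; apply/negP => /MP[_].
by rewrite ltnn.
Qed.

Lemma not_card_le_II (T : Type) (A : set T) m : ~ (A #<= `I_m) ->
  exists f : nat -> T, (forall j, (j < m.+1)%N -> A (f j)) /\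
    forall j j', (j < m.+1)%N -> (j' < m.+1)%N -> f j = f j' -> j = j'.
Proof.
move=> nA; have le : `I_m.+1 #<= A.
  have [[n An]|/infiniteP nleA] := pselect (finite_set A); last first.
    exact: card_le_trans (card_leT _) nleA.
  rewrite (card_le_eqr An) card_le_II ltnNge; apply/negP => nm; apply: nA.
  by rewrite (card_le_eql An) card_le_II.
have [t0 _] : A !=set0.
  apply: contrapT => /nonemptyPn A0; apply: nA; rewrite A0; exact: card_ge0.
by have [f ? ?] := card_le_funP t0 le; exists f.
Qed.

(* At infinitely many coordinates [i], [m + 1] given functions are mapped to
   distinct elements of [b i]: a slalom localizes the images of at most [m]
   functions. *)
Lemma Lc_nat_tukey_bounded m :
  (\forall i \near \oo, clt (cardof 'I_(h i)) (cardof (b i))) ->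
  (\forall i \near \oo, (m <= h i)%N) -> infinite_set [set i | h i = m] ->
  tukey (Lc (fun=> nat) h) (Lc b h).
Proof.
move=> hb hm him.
pose emb i (f : nat -> b i) :=
  forall j j', (j < m.+1)%N -> (j' < m.+1)%N -> f j = f j' -> j = j'.
have inc_ex i : exists f : nat -> b i, (exists g, @emb i g) -> emb i f.
  have [d _] := b_neq0 i; have [[g gP]|ng] := pselect (exists g, @emb i g).
    by exists g.
  by exists (fun=> d).
pose inc i := sval (cid (inc_ex i)).
have inc_inj i : (exists g, @emb i g) -> emb i (inc i).
  by rewrite /inc; case: cid.
(* Where [h i = m], the bound [h i < |b i|] provides [m.+1] distinct elements of [b i]. *)
have /infinite_nat_enum[e e_inj eP] :
    infinite_set [set i | h i = m /\ exists g, @emb i g].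
  apply: sub_infinite_set (infinite_near hb him) => i [/= hi [hle hneq]].
  split=> //; rewrite hi in hle hneq.
  have nle : ~ ([set: b i] #<= `I_m).
    rewrite (card_le_eqr card_II) => ble; apply: hneq; apply: cle_anti => //.
    exact/cle_cardof.
  by have [f [_ f_inj]] := not_card_le_II nle; exists f.
(* The coordinates [e k] run through all pairs of a length and a list of finite sequences; [F x]
   records at such a coordinate the position of the prefix of [x] in the list. *)
pose task i : nat * seq (seq nat) := xget (0, [::]) [set t | e (pickle t) = i].
have taskE t : task (e (pickle t)) = t.
  rewrite /task; case: xgetP => [t' _ /e_inj/(pcan_inj pickleK)//|/(_ t)].
  by case.
pose F (x : nat -> nat) i := inc i (index (mkseq x (task i).1) (task i).2).
pose loc (phi : forall i, set (b i)) := [set x | localizes phi (F x)].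
have loc_le phi : slaloms h phi -> loc phi #<= `I_m.
  move=> sphi; apply: contrapT => /not_card_le_II[xs [xsloc xs_inj]].
  have [N0 HN0] : exists N, forall j n, (j < m.+1)%N -> (N <= n)%N ->
      phi n (F (xs j) n).
    by apply: eventually_forall_lt => j /xsloc/near_natP.
  have [n0 Hn0] : exists N, forall j n, (j < m.+1)%N -> (N <= n)%N ->
      forall j', (j' < m.+1)%N -> mkseq (xs j) n = mkseq (xs j') n -> j = j'.
    apply: eventually_forall_lt => j jm.
    have [|N HN] := @eventually_forall_lt (fun j' n =>
      mkseq (xs j) n = mkseq (xs j') n -> j = j') m.+1.
      move=> j' jm'; have [xE|xN] := pselect (xs j = xs j').
        by exists 0 => n _ _; exact: xs_inj.
      have /existsNP[p np] : ~ forall p, xs j p = xs j' p.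
        by move=> H; apply: xN; exact/funext.
      exists p.+1 => n pn /(congr1 (fun s => nth 0 s p)).
      by rewrite !nth_mkseq.
    by exists N => n Nn j' jm'; exact: HN.
  (* The task listing the prefixes of the [m.+1] functions: for [n >= n0] they are distinct, and for
     [n >= N1] the coordinate lies where all of them are localized. The slalom would then have more
     than [m] elements there. *)
  pose t n := (n, [seq mkseq (xs j) n | j <- iota 0 m.+1]).
  have [|N1 HN1] := @inj_diverge (fun n => e (pickle (t n))) N0.
    by move=> n n' /e_inj/(pcan_inj pickleK) [].
  pose n := maxn n0 N1; pose i := e (pickle (t n)).
  have N0i : (N0 <= i)%N by apply: HN1; rewrite leq_max leqnn orbT.
  have [him' iemb] := eP (pickle (t n)); rewrite -/i in him' iemb.
  have Fi j : (j < m.+1)%N -> F (xs j) i = inc i j.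
    move=> jm; rewrite /F /i taskE; congr inc; have -> : (t n).1 = n by [].
    have jE : mkseq (xs j) n = nth [::] (t n).2 j.
      by rewrite (nth_map 0) ?size_iota// nth_iota.
    rewrite jE; apply: index_uniq; first by rewrite size_map size_iota.
    rewrite map_inj_in_uniq ?iota_uniq// => k k'; rewrite !mem_iota /= => km km'.
    by apply: Hn0 => //; rewrite leq_max leqnn.
  have : `I_m.+1 #<= `I_(h i).
    apply: card_le_trans (sphi i).
    apply: (card_le_rel (r := fun j z => z = inc i j)) => [j jm|j j' _ jm jm' ->].
      by exists (inc i j) => //; rewrite -Fi//; exact: HN0.
    exact: inc_inj.
  by rewrite card_le_II him' ltnn.
(* The new slalom consists of the values of the at most [m] localized functions; it is empty where
   [h i < m]. *)
exists F, (fun phi i => [set v | (m <= h i)%N /\ ((fun x => x i) @` loc phi) v]).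
move=> x phi [sphi xphi]; split=> [i|].
  have [mi|nmi] := pselect (m <= h i)%N; last first.
    rewrite (_ : [set v | _] = set0); first exact: card_ge0.
    by apply/seteqP; split=> // v [].
  apply: (@card_le_trans _ _ _ `I_m); last by rewrite card_le_II.
  apply: card_le_trans (loc_le _ sphi).
  apply: card_le_trans (card_image_le (fun x => x i) _).
  by apply: subset_card_le => v [].
move/near_natP: hm => [N HN]; apply/near_natP; exists N => i /HN mi.
by split=> //; exists x.
Qed.

End LocalizationNat.

(** * Limits of cardinals and the theorem *)

Lemma infinite_dnum_tukey (X Y X' Y' : Type) (r : X -> Y -> Prop)
    (r' : X' -> Y' -> Prop) :
  tukey r r' -> infinite_dnum r -> infinite_dnum r'.
Proof.
move=> [f [g fg]] rinf D DP; apply: card_le_infinite (card_image_le g D) _.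
by apply: rinf => x; have [y Dy ry] := DP (f x); exists (g y); [exists y|exact: fg].
Qed.

(** A bound of the finite sets [phi n] dominates every localized function. This shows that
    dominating families for localization are infinite. *)
Lemma io_le_tukey_Lc h : tukey io_le (Lc (fun=> nat) h).
Proof.
have /choice[beta betaP] : forall phi : nat -> set nat, exists f : nat -> nat,
    slaloms h phi -> forall n v, phi n v -> (v <= f n)%N.
  move=> phi; have [sphi|nsphi] := pselect (slaloms h phi); last by exists id.
  have /choice[f fP] : forall n, exists N, forall v, phi n v -> (v <= N)%N.
    move=> n; apply: contrapT => /forallNP H.
    have fin : finite_set (phi n) by apply/finite_set_leP; exists (h n); exact: sphi.
    suff : infinite_set (phi n) by [].
    apply/infinite_natP => N; have /existsNP[v /not_implyP[pv nv]] := H N.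
    by exists v => //; rewrite leqNgt; apply/negP => /ltnW.
  by exists f.
exists id, beta => f phi [sphi /near_natP[N HN]].
apply/infinite_natP => n; exists (maxn n N); first exact: leq_maxl.
by apply: betaP => //; apply: HN; exact: leq_maxr.
Qed.

Lemma Lc_nat_tukey (b : nat -> Type) (h : nat -> nat) :
  (forall i, [set: b i] !=set0) ->
  (\forall i \near \oo, clt (cardof 'I_(h i)) (cardof (b i))) ->
  infinite_set [set i | infinite_set [set: b i]] ->
  tukey (Lc (fun=> nat) h) (Lc b h).
Proof.
move=> b0 hb binf.
have [hinf|/existsNP nh] := pselect (forall m, \forall i \near \oo, (m <= h i)%N).
  exact: Lc_nat_tukey_unbounded.
(* The least such number is [m.+1] with [m] the lower limit of [h]: eventually [m <= h i], and
   infinitely often equality holds. *)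
have {nh} : exists m, `[< ~ \forall i \near \oo, (m <= h i)%N >].
  by case: nh => m nm; exists m; exact/asboolP.
move=> /ex_minnP[[|m] /asboolP nm min]; first by case: nm; apply/near_natP; exists 0.
have hm : \forall i \near \oo, (m <= h i)%N.
  apply: contrapT => nhm; have := min m; rewrite ltnn => H.
  by have : false by apply: H; exact/asboolP.
apply: (@Lc_nat_tukey_bounded _ _ b0 m) => //.
have lem : infinite_set [set i | (h i <= m)%N].
  apply/infinite_natP => n; apply: contrapT => /forall2NP H; apply: nm.
  apply/near_natP; exists n => i ni; rewrite ltnNge; apply/negP => him.
  by case: (H i).
apply: sub_infinite_set (infinite_near hm lem) => i [/= hi1 hi2].
by apply/eqP; rewrite eqn_leq hi1.
Qed.

(** * Limits of cardinals as disjoint unions *)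

Section SigmaEmbedding.
Variables (b : nat -> Type) (h : nat -> nat) (K : Type) (T : nat -> Type).
Hypothesis b_neq0 : forall i, [set: b i] !=set0.
Hypothesis Kinf : infinite_set [set: K].
Variables (j : K -> {n : nat & T n}) (j_inj : injective j).

Let embeds n i := infinite_set [set: b i] /\ exists f : T n -> b i, injective f.

Let Ks i : set K := [set z | embeds (tag (j z)) i].

(** The summand [T n] embeds in [b i]; pairing with the tag [n] keeps different summands apart, and
    the pairs fit into the infinite type [b i]. *)
Let emb_ex : exists u : forall i, K -> b i,
  forall i z z', Ks i z -> Ks i z' -> u i z = u i z' -> z = z'.
Proof.
have w_ex n i : exists f : T n -> b i, embeds n i -> injective f.
  have [d _] := b_neq0 i; have [[_ [f f_inj]]|nemb] := pselect (embeds n i).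
    by exists f.
  by exists (fun=> d).
have p_ex i : exists f : nat * b i -> b i, infinite_set [set: b i] -> injective f.
  have [d _] := b_neq0 i.
  have [/nat_prod_inj[f f_inj]|nb] := pselect (infinite_set [set: b i]).
    by exists f.
  by exists (fun=> d).
pose w n i := sval (cid (w_ex n i)); pose p i := sval (cid (p_ex i)).
have w_inj n i : embeds n i -> injective (w n i) by rewrite /w; case: cid.
have p_inj i : infinite_set [set: b i] -> injective (p i) by rewrite /p; case: cid.
exists (fun i z => p i (tag (j z), w (tag (j z)) i (tagged (j z)))) => i z z'.
move=> Kz _ /(p_inj i Kz.1) E; apply: j_inj; move: Kz E; rewrite /Ks /=.
case: (j z) => n x; case: (j z') => n' x' /= emb [nn']; move: x' emb.
by case: n' / nn' => x' emb /(w_inj _ _ emb) ->.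
Qed.

Lemma sigma_tukey_aLc_dual :
  (forall n, \forall i \near \oo, embeds n i) -> tukey (in_ctbl K) (aLc_dual b h).
Proof.
move=> emb; have [u u_inj] := emb_ex.
by apply: (in_ctbl_tukey_aLc_dual _ b_neq0 Kinf u_inj) => [i z []//|z]; exact: emb.
Qed.

Lemma sigma_tukey_Lc :
  (forall n, infinite_set [set i | embeds n i]) -> tukey (in_ctbl K) (Lc b h).
Proof.
move=> emb; have [u u_inj] := emb_ex.
by apply: (in_ctbl_tukey_Lc _ b_neq0 Kinf u_inj) => [i z []//|z]; exact: emb.
Qed.

End SigmaEmbedding.

Lemma csupP (P : cardinal -> Prop) : (exists k, forall l, P l -> cle l k) ->
  (forall l, P l -> cle l (csup P)) /\
  forall k, (forall l, P l -> cle l k) -> cle (csup P) k.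
Proof. by move=> /cminP. Qed.

Lemma Tagged_inj (T : nat -> Type) n : injective (@Tagged _ n T).
Proof.
move=> x y /(congr1 (tagged_as (Tagged T x))).
by rewrite !tagged_asE.
Qed.

Lemma infinite_carrier (A : Type) k :
  infinite_set [set: A] -> cle (cardof A) k -> infinite_set [set: carrier k].
Proof.
move=> Ainf /carrier_cleP[f f_inj]; apply: card_le_infinite Ainf.
exact/card_le_typeP/(ex_intro _ f).
Qed.

Section LimInf.
Variable b : nat -> Type.
Let s i := cardof (b i).
Let m n := cmin (fun l => exists2 i, (n <= i)%N & l = s i).
Let kappa := climinf s.

Let mP n : (exists2 i, (n <= i)%N & m n = s i) /\
  forall i, (n <= i)%N -> cle (m n) (s i).
Proof.
have [|mex mle] := @cminP (fun l => exists2 i, (n <= i)%N & l = s i).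
  by exists (s n), n.
by split=> // i ni; apply: mle; exists i.
Qed.

Let kappaP : (forall n, cle (m n) kappa) /\
  forall k, (forall n, cle (m n) k) -> cle kappa k.
Proof.
have [|ub lub] := @csupP (fun k => exists n, k = m n).
  exists (cardof {n : nat & carrier (m n)}) => _ [n ->].
  by apply/cle_carrierP; exists (@Tagged _ n (fun n => carrier (m n))); exact: Tagged_inj.
by split=> [n|k kP]; [apply: ub; exists n|apply: lub => _ [n ->]].
Qed.

Lemma climinf_infinitely_le :
  infinite_set [set i | cle (s i) kappa].
Proof.
apply/infinite_natP => n; have [[i ni mE] _] := mP n.
by exists i => //=; rewrite -mE; exact: kappaP.1.
Qed.

Lemma climinf_infinite : (\forall i \near \oo, infinite_set [set: b i]) ->
  infinite_set [set: carrier kappa].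
Proof.
move=> binf; have := infinite_near binf climinf_infinitely_le.
move=> /infinite_natP/(_ 0)[i _ [/= sk bi]].
exact: infinite_carrier bi sk.
Qed.

(** The supremum [kappa] of the tail minima [m n] embeds in their disjoint union, and [m n] is at
    most the size of every [b i] with [i >= n]. *)
Lemma climinf_tukey h : (forall i, [set: b i] !=set0) ->
  (\forall i \near \oo, infinite_set [set: b i]) ->
  tukey (in_ctbl (carrier kappa)) (aLc_dual b h).
Proof.
move=> b0 binf.
have [|j j_inj] := (cle_carrierP kappa {n : nat & carrier (m n)}).1.
  apply: kappaP.2 => n.
  by apply/cle_carrierP; exists (@Tagged _ n (fun n => carrier (m n))); exact: Tagged_inj.
apply: (sigma_tukey_aLc_dual _ b0 (climinf_infinite binf) j_inj) => n.
have /near_natP[N HN] := binf; apply/near_natP; exists (maxn n N) => i.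
rewrite geq_max => /andP[ni Ni]; split; first exact: HN.
exact/cle_carrierP/(mP n).2.
Qed.

End LimInf.

Section LimSup.
Variable b : nat -> Type.
Let s i := cardof (b i).
Let S n := csup (fun l => exists2 i, (n <= i)%N & l = s i).
Let lambda := climsup s.

Let SP n : (forall i, (n <= i)%N -> cle (s i) (S n)) /\
  forall k, (forall i, (n <= i)%N -> cle (s i) k) -> cle (S n) k.
Proof.
have [|ub lub] := @csupP (fun l => exists2 i, (n <= i)%N & l = s i).
  exists (cardof {i : nat & b i}) => _ [i _ ->].
  by apply/cle_typeP; exists (@Tagged _ i b); exact: Tagged_inj.
by split=> [i ni|k kP]; [apply: ub; exists i|apply: lub => _ [i ni ->]; exact: kP].
Qed.

Let lambdaP : (exists n, lambda = S n) /\ forall n, cle lambda (S n).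
Proof.
have [|lex lle] := @cminP (fun k => exists n, k = S n); first by exists (S 0), 0.
by split=> // n; apply: lle; exists n.
Qed.

Lemma climsup_near_le : \forall i \near \oo, cle (s i) lambda.
Proof.
have [[n ->] _] := lambdaP; apply/near_natP; exists n; exact: (SP n).1.
Qed.

Lemma climsup_infinite : infinite_set [set i | infinite_set [set: b i]] ->
  infinite_set [set: carrier lambda].
Proof.
move=> /(infinite_near climsup_near_le)/infinite_natP/(_ 0)[i _ [/= bi sl]].
exact: infinite_carrier bi sl.
Qed.

Lemma climsup_tukey h : (forall i, [set: b i] !=set0) ->
  infinite_set [set i | infinite_set [set: b i]] ->
  tukey (in_ctbl (carrier lambda)) (Lc b h).
Proof.
move=> b0 binf; have linf := climsup_infinite binf.
(* If [lambda] is attained infinitely often, it embeds directly in infinitely many [b i], and a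
   constant family of summands suffices. *)
have [lei|] := pselect (infinite_set [set i | cle lambda (s i)]).
  apply: (@sigma_tukey_Lc b h _ (fun=> carrier lambda) b0 linf (Tagged _ (i := 0))).
    exact: Tagged_inj.
  move=> _; apply: sub_infinite_set lei => i /= /cle_carrierP[f f_inj].
  split; last by exists f.
  by apply: card_le_infinite linf; apply/card_le_typeP; exists f.
move=> nlei; have [N HN] : exists N, forall i, (N <= i)%N -> ~ cle lambda (s i).
  apply: contrapT => /forallNP H; apply: nlei; apply/infinite_natP => n.
  by have /existsNP[i /not_implyP[ni /contrapT]] := H n; exists i.
(* Otherwise all [b i] with [i >= N] are smaller than [lambda], and their disjoint union serves;
   each of them embeds in infinitely many infinite [b i]. *)
have [|j j_inj] := (cle_carrierP lambda {n : nat & b (N + n)%N}).1.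
  apply: cle_trans (lambdaP.2 N) _; apply: (SP N).2 => i Ni.
  rewrite /s -(subnKC Ni); apply/cle_typeP.
  by exists (@Tagged _ (i - N)%N (fun n => b (N + n)%N)); exact: Tagged_inj.
apply: (sigma_tukey_Lc _ b0 linf j_inj) => n; apply/infinite_natP => M.
have [bn|bn] := pselect (finite_set [set: b (N + n)%N]).
  have [i Mi bi] := (infinite_natP _).1 binf M; exists i => //; split=> //.
  have [//|[f f_inj]] := card_le_total (b (N + n)%N) (b i).
  by case: bi; apply: card_le_finite bn; apply/card_le_typeP; exists f.
(* If no later [b i] were larger than [b (N + n)], then [lambda] would be at most the size of
   [b (N + n)]. *)
have [i Mi nle] : exists2 i, (M <= i)%N & ~ cle (s i) (s (N + n)%N).
  apply: contrapT => /forall2NP H; apply: (HN (N + n)%N (leq_addr _ _)).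
  apply: cle_trans (lambdaP.2 M) _; apply: (SP M).2 => i Mi.
  by have [//|/contrapT] := H i.
exists i => //; have [//|/cle_typeP[f f_inj]] := cle_total (s i) (s (N + n)%N).
split; last by exists f.
by apply: card_le_infinite bn; apply/card_le_typeP; exists f.
Qed.

End LimSup.

(** * Values at aleph_0 and bounds by aleph_1 *)

Lemma cle_aleph0P (T : Type) (F : set T) :
  cle (cardof F) aleph0 <-> countable F.
Proof. by rewrite cle_cardof (card_le_eql (card_setT _)). Qed.

Lemma aleph1P k : uncountable k -> uncountable aleph1 /\ cle aleph1 k.
Proof.
move=> uk; have [|u1 min] := @cminP uncountable; first by exists k.
by split=> //; exact: min.
Qed.

Lemma aleph1_least_size (T : Type) (P : set T -> Prop) :
  (forall F, P F -> ~ countable F) -> ele (Some aleph1) (least_size P).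
Proof.
move=> PF; apply: ele_least_size => F /PF nF.
by apply: (aleph1P _).2 => /cle_aleph0P.
Qed.

Lemma uncountable_infinite k : uncountable k -> infinite_set [set: carrier k].
Proof.
move=> uk /finite_set_countable ck; apply: uk.
by rewrite -(carrierK k); apply/cle_cardof.
Qed.

(** A countable union of countable sets is countable, whereas aleph_1 many points are not contained
    in one countable set. *)
Lemma add_ctbl_uncountable k : uncountable k -> add_ctbl k = Some aleph1.
Proof.
move=> uk; have [C cC] := infinite_ctbl_subset (uncountable_infinite uk).
apply: ele_anti; last first.
  apply: aleph1_least_size => F [cF nF] Fc; apply: nF.
  exists (C `|` \bigcup_(A in F) A) => [|A FA x Ax]; last by right; exists A.
  apply: ctbl_subsetsU => //; apply: bigcup_countable => // A /cF.
  by move=> /ctbl_subsetsP[].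
have [u1 le1] := aleph1P uk.
move: le1; rewrite -(carrierK aleph1) => /carrier_cleP[w w_inj].
pose F := range (fun x => C `|` [set w x]).
apply: (@ele_trans _ (Some (cardof F))); last first.
  apply/cle_cardof; rewrite (card_le_eql (card_setT _)); exact: card_image_le.
apply: least_size_le; split=> [_ [x _ <-]|[B /ctbl_subsetsP[cB _] BP]].
  by apply: ctbl_subsetsU => //; exact: countable1.
apply: u1; rewrite -(carrierK aleph1); apply/cle_cardof.
apply: card_le_trans cB; apply: (card_le_rel (r := fun x y => y = w x)).
  by move=> x _; exists (w x) => //; apply: (BP (C `|` [set w x])); [exists x|right].
by move=> x x' _ _ _ -> /w_inj.
Qed.

Lemma ctbl_setT_aleph0 : ctbl_subsets (carrier aleph0) [set: carrier aleph0].
Proof. exact: carrier_cardof. Qed.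

Lemma add_ctbl_aleph0 : add_ctbl aleph0 = None.
Proof.
rewrite /add_ctbl.
set P := (fun F : set (set (carrier aleph0)) => _).
have [[F [[_ nF] _ _]]|[]//] := least_sizeP P.
by case: nF; exists setT => //; exact: ctbl_setT_aleph0.
Qed.

(** The whole type is a cofinal family by itself, and [x0] makes every dominating family
    nonempty. *)
Lemma cof_ctbl_aleph0 (X Y : Type) (r : X -> Y -> Prop) (x0 : X) :
  ele (cof_ctbl aleph0) (dnum r).
Proof.
apply: (le_least_size_image (f := fun=> setT)) => D DP; have [y Dy _] := DP x0.
split=> [_ [_ _ <-]|A _]; first exact: ctbl_setT_aleph0.
by exists setT => //; exists y.
Qed.

Lemma aleph1_dual_io_eq : ele (Some aleph1) (dnum (dual io_eq)).
Proof.
apply: aleph1_least_size => F FP /countable_bounded_io_eq[g gP].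
by have [f Ff] := FP g; apply; exact: gP.
Qed.

(** For [h = 1] a function becomes the slalom of its singletons. *)
Lemma io_eq_on_tukey_io_eq : tukey io_eq_on io_eq.
Proof.
apply: tukey_trans (io_eq_on_tukey (fun=> 1)) _.
exists id, (fun g n => [set g n]) => f g fg; split=> // n.
have := card_eqPle [set g n] `I_1.
by rewrite card_set1 => -[H _]; have [] := H isT.
Qed.

(** Both factors of [meager_tukey_comp] lie below [io_eq], for which countable families are
    bounded. *)
Lemma aleph1_cov_meager (R : realType) : ele (Some aleph1) (cov_meager R).
Proof.
rewrite cov_meagerE -[@in_meager R]dualK.
apply: ele_trans (tukey_comp_dual (meager_tukey_comp R)).
apply: ele_trans aleph1_dual_io_eq _.
apply: emin_glb; apply/tukey_dnum/tukey_dual; first exact: io_le_tukey.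
exact: io_eq_on_tukey_io_eq.
Qed.

(** A countable family is localized by collecting at [n] the values of its first [h n] members. *)
Lemma aleph1_dual_Lc_nat h : (forall m, \forall i \near \oo, (m <= h i)%N) ->
  ele (Some aleph1) (dnum (dual (Lc (fun=> nat) h))).
Proof.
move=> hinf; apply: aleph1_least_size => F FP /pcard_injP[c c_inj].
have [x Fx] := FP (fun n => (fun x => x n) @` [set x | F x /\ (c x < h n)%N]); apply.
split=> [n|].
  apply: card_le_trans (card_image_le _ _) _; apply/card_le_IIP.
  by exists c => [x' []//|y y' [Fy _] [Fy' _]]; apply: c_inj; rewrite inE.
apply: filterS (hinf (c x).+1) => n hn /=.
by exists x.
Qed.

(** * The equalities between the cardinals *)

Lemma aLc_cardinals (R : realType) (b : nat -> Type) (h : nat -> nat)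
    (kappa := climinf (fun i => cardof (b i))) :
  (\forall i \near \oo, (1 <= h i)%N) -> (forall i, [set: b i] !=set0) ->
  (\forall i \near \oo, infinite_set [set: b i]) ->
  baLc b h = emax (cof_ctbl kappa) (non_meager R) /\
  daLc b h = emin (add_ctbl kappa) (cov_meager R).
Proof.
move=> h1 b0 binf; have kinf := climinf_infinite binf.
have kb : tukey (in_ctbl (carrier kappa)) (aLc_dual b h) by exact: climinf_tukey.
have bk : tukey_comp (aLc_dual b h) (in_ctbl (carrier kappa)) io_eq.
  have v_ex i : exists f : b i -> carrier kappa,
      cle (cardof (b i)) kappa -> injective f.
    have [/carrier_cleP[f f_inj]|nle] := pselect (cle (cardof (b i)) kappa).
      by exists f.
    by have [f _] := (infinite_typeP _).1 kinf; exists (fun=> f 0).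
  pose v i := sval (cid (v_ex i)).
  apply: (@aLc_dual_tukey_comp _ _ _ v).
  apply: sub_infinite_set (infinite_near h1 (@climinf_infinitely_le b)).
  by move=> i [/= le hi]; split=> //; rewrite /v; case: cid => f /= /(_ le).
have nb : tukey io_eq_on (aLc_dual b h).
  exact: tukey_trans (io_eq_on_tukey h) (aLc_dual_nat_tukey _ b0 binf).
have lb : tukey io_le (aLc_dual b h).
  exact: tukey_trans io_le_tukey (tukey_trans io_eq_tukey nb).
(* [eN] puts [io_eq] below non(M), and [Nc] puts non(M) below [io_le] and [io_eq_on], which both lie
   below the relation for [b]; this closes the circle. *)
have eN := @io_eq_tukey_meager R; have Nc := @meager_tukey_comp R.
have einf : infinite_dnum io_eq.
  exact: infinite_dnum_tukey io_le_tukey infinite_dnum_io_le.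
have oinf := infinite_dnum_tukey io_eq_tukey einf.
split.
  rewrite baLcE non_meagerE cof_ctblE//; apply: ele_anti.
    apply: ele_trans (tukey_comp_dnum einf bk) _; apply: emax_lub (emaxl _ _) _.
    exact: ele_trans (tukey_dnum eN) (emaxr _ _).
  apply: emax_lub; first exact: tukey_dnum.
  apply: ele_trans (tukey_comp_dnum oinf Nc) _.
  by apply: emax_lub; exact: tukey_dnum.
rewrite daLcE cov_meagerE add_ctblE// -{1}[@in_meager R]dualK; apply: ele_anti.
  apply: emin_glb; first exact/tukey_dnum/tukey_dual.
  apply: ele_trans _ (tukey_comp_dual Nc).
  by apply: emin_glb; exact/tukey_dnum/tukey_dual.
apply: ele_trans _ (tukey_comp_dual bk); apply: emin_glb (eminl _ _) _.
by apply: ele_trans (eminr _ _) _; exact/tukey_dnum/tukey_dual.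
Qed.

Lemma Lc_cardinals (b : nat -> Type) (h : nat -> nat)
    (lambda := climsup (fun i => cardof (b i))) :
  (forall i, [set: b i] !=set0) ->
  (\forall i \near \oo, clt (cardof 'I_(h i)) (cardof (b i))) ->
  infinite_set [set i | infinite_set [set: b i]] ->
  bLc b h = emin (add_ctbl lambda) (bLc (fun=> nat) h) /\
  dLc b h = emax (cof_ctbl lambda) (dLc (fun=> nat) h).
Proof.
move=> b0 hb binf; have linf := climsup_infinite binf.
have lb : tukey (in_ctbl (carrier lambda)) (Lc b h) by exact: climsup_tukey.
have nb := Lc_nat_tukey b0 hb binf.
have bl : tukey_comp (Lc b h) (in_ctbl (carrier lambda)) (Lc (fun=> nat) h).
  have v_ex i : exists f : b i -> carrier lambda,
      cle (cardof (b i)) lambda -> injective f.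
    have [/carrier_cleP[f f_inj]|nle] := pselect (cle (cardof (b i)) lambda).
      by exists f.
    by have [f _] := (infinite_typeP _).1 linf; exists (fun=> f 0).
  pose v i := sval (cid (v_ex i)).
  apply: (@Lc_tukey_comp _ _ _ v).
  apply: filterS (climsup_near_le b) => i le.
  by rewrite /v; case: cid => f /= /(_ le).
have ninf := infinite_dnum_tukey (io_le_tukey_Lc h) infinite_dnum_io_le.
rewrite !bLcE !dLcE add_ctblE// cof_ctblE//; split; apply: ele_anti.
- by apply: emin_glb; exact/tukey_dnum/tukey_dual.
- exact: tukey_comp_dual.
- exact: tukey_comp_dnum.
- by apply: emax_lub; exact: tukey_dnum.
Qed.

Theorem theorem3p4 (R : realType) (b : nat -> Type) (h : nat -> nat)
  (h_ge1 : \forall i \near \oo, (1 <= h i)%N)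
  (b_neq0 : forall i, [set: b i] !=set0)
  (h_lt_b : \forall i \near \oo, clt (cardof 'I_(h i)) (cardof (b i))) :
  ((\forall i \near \oo, infinite_set [set: b i]) ->
    let kappa := climinf (fun i => cardof (b i)) in
    [/\ baLc b h = emax (cof_ctbl kappa) (non_meager R),
        daLc b h = emin (add_ctbl kappa) (cov_meager R),
        kappa = aleph0 ->
          baLc b h = non_meager R /\ daLc b h = cov_meager R
      & uncountable kappa -> daLc b h = Some aleph1]) /\
  (infinite_set [set i | infinite_set [set: b i]] ->
    let lambda := climsup (fun i => cardof (b i)) in
    [/\ bLc b h = emin (add_ctbl lambda) (bLc (fun=> nat) h),
        dLc b h = emax (cof_ctbl lambda) (dLc (fun=> nat) h),
        lambda = aleph0 ->
          bLc b h = bLc (fun=> nat) h /\ dLc b h = dLc (fun=> nat) h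
      & uncountable lambda -> h @ \oo --> \oo -> bLc b h = Some aleph1]).
Proof.
split=> [binf kappa|binf lambda].
  have [baE daE] := aLc_cardinals R h_ge1 b_neq0 binf.
  split=> // [k0|ku].
    rewrite baE daE -/kappa k0 add_ctbl_aleph0 eminNone emax_idPr// non_meagerE.
    exact: (@cof_ctbl_aleph0 _ _ _ set0).
  rewrite daE -/kappa add_ctbl_uncountable// emin_idPl//.
  exact: aleph1_cov_meager.
have [bE dE] := Lc_cardinals b_neq0 h_lt_b binf.
split=> // [l0|lu hoo].
  rewrite bE dE -/lambda l0 add_ctbl_aleph0 eminNone emax_idPr// dLcE.
  exact: (@cof_ctbl_aleph0 _ _ _ (fun=> 0)).
rewrite bE -/lambda add_ctbl_uncountable// emin_idPl// bLcE.
apply: aleph1_dual_Lc_nat => m.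
by move/cvgnyPge: hoo; apply.
Qed.
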